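(* Let $\mathcal O$ be a discrete valuation ring with maximal ideal $\wp$ and finite residue field, let $k\ge 1$, $\mathcal O_k=\mathcal O/\wp^k$, $F=\mathcal O_k^{\,n}$, $G=\mathrm{Aut}(F)=GL(n,\mathcal O_k)$, and let $\phi=k^m=(k,\ldots,k)$ ($m$ entries), where $m\le n/2$. Then there exists a collection of pairwise non-equivalent irreducible $G$-representations $\{\mathcal U_\lambda\}_{\lambda\le\phi}$ (over $\mathbb Q$) such that: (1) $\mathcal F_\phi\simeq\bigoplus_{\lambda\le\phi}\mathcal U_\lambda$. (2) For every $\lambda,\nu\le\phi$, $\langle\mathcal U_\lambda,\mathcal F_\nu\rangle=|\{\lambda\hookrightarrow\nu\}|$; that is, the multiplicity of $\mathcal U_\lambda$ in $\mathcal F_\nu$ is the number of non-equivalent embeddings of a module of type $\lambda$ in a module of type $\nu$. In particular $\mathcal U_\lambda$ appears in $\mathcal F_\lambda$ with multiplicity one and does not appear in $\mathcal F_\nu$ unless $\lambda\le\nu$.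
   Context: Any finite $\mathcal O$-module is isomorphic to $\bigoplus_{i=1}^{l}\mathcal O/\wp^{\lambda_i}$ with $\lambda_1\ge\dots\ge\lambda_l$; its type (isomorphism class) is identified with the partition $\lambda=(\lambda_1,\ldots,\lambda_l)$. Write $\lambda\le\nu$ if a module of type $\lambda$ can be embedded in a module of type $\nu$. Two injections $i:x\hookrightarrow y$ and $i':x'\hookrightarrow y'$ are equivalent if there are isomorphisms $x\to x'$ and $y\to y'$ making the square with $i,i'$ commute; $\{\lambda\hookrightarrow\nu\}$ denotes the set of equivalence classes of injections from a module of type $\lambda$ into a module of type $\nu$. $X_\lambda$ is the set of submodules of $F$ of type $\lambda$, and $\mathcal F_\lambda$ is the space of $\mathbb Q$-valued functions on $X_\lambda$, with the $G$-action $[gf](x)=f(g^{-1}x)$. $\langle\mathcal U,\mathcal F\rangle$ denotes the multiplicity of the irreducible representation $\mathcal U$ in $\mathcal F$. *)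

(* Defs.v *)
From HB Require Import structures.
From mathcomp Require Import all_boot all_order all_algebra all_fingroup.
From mathcomp Require Import mxrepresentation character.
From mathcomp Require Import boolp.
Set Implicit Arguments.
Unset Strict Implicit.
Unset Printing Implicit Defensive.
Import GroupScope GRing.Theory.
Local Open Scope ring_scope.

Section Rings.
Variable O : idomainType.
Implicit Types I J P : O -> Prop.

Definition is_ideal I :=
  [/\ I 0, forall x y, I x -> I y -> I (x + y) & forall a x, I x -> I (a * x)].

Definition maximal_ideal I :=
  [/\ is_ideal I, ~ I 1 &
      forall J, is_ideal J -> (forall x, I x -> J x) -> ~ J 1 ->
      forall x, J x -> I x].

(* The k-th power of an ideal: the smallest ideal containing all products of k
   elements of I. *)
Definition ideal_exp I (k : nat) (x : O) :=
  forall J, is_ideal J ->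
    (forall t : 'I_k -> O, (forall i, I (t i)) -> J (\prod_i t i)) -> J x.

(* O is a discrete valuation ring (a local principal ideal domain that is not a
   field) and P is its maximal ideal. *)
Definition is_dvr P :=
  [/\ maximal_ideal P,
      forall J, maximal_ideal J -> forall x, J x <-> P x,
      exists2 x, P x & x != 0 &
      forall I, is_ideal I -> exists p, forall x, I x <-> exists a, x = a * p].

Definition finite_quotient P :=
  exists s : seq O, forall x, exists2 y, y \in s & P (x - y).

(* red exhibits R as the quotient ring O / I. *)
Definition is_quotient I (R : nzRingType) (red : {rmorphism O -> R}) :=
  (forall r, exists a, red a = r) /\ (forall a, red a = 0 <-> I a).

End Rings.

Definition is_partition (la : seq nat) := sorted geq la && (0%N \notin la).

Section Types.
Variables (O : idomainType) (P : O -> Prop).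

(* The submodule X of M is isomorphic to the direct sum of the O / P^(la_i):
   by the first isomorphism theorem, such an isomorphism is the same thing as a
   linear map from O^l onto X whose kernel is the product of the P^(la_i). *)
Definition submod_type (M : lmodType O) (X : M -> Prop) (la : seq nat) :=
  exists f : {linear 'rV[O]_(size la) -> M},
    (forall v, X v <-> exists a, v = f a) /\
    (forall a, f a = 0 <-> forall i : 'I_(size la), ideal_exp P (nth 0%N la i) (a 0 i)).

Definition has_type (M : lmodType O) la := submod_type (fun _ : M => True) la.

Record embedding (la nu : seq nat) := Embedding {
  emb_src : lmodType O;
  emb_tgt : lmodType O;
  emb_map :> {linear emb_src -> emb_tgt};
  emb_inj : injective emb_map;
  emb_srcP : has_type emb_src la;
  emb_tgtP : has_type emb_tgt nu
}.

Definition emb_equiv la nu (i i' : embedding la nu) :=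
  exists (f : {linear emb_src i -> emb_src i'})
         (g : {linear emb_tgt i -> emb_tgt i'}),
    [/\ bijective f, bijective g & forall x, g (i x) = i' (f x)].

Definition type_le la nu := inhabited (embedding la nu).

(* There are exactly N equivalence classes of embeddings. *)
Definition emb_classes la nu (N : nat) :=
  exists c : 'I_N -> embedding la nu,
    (forall s t, emb_equiv (c s) (c t) -> s = t) /\
    (forall i, exists s, emb_equiv (c s) i).

End Types.

Section PermutationRepresentation.
Variables (gT : finGroupType) (G : {group gT}) (T : finType).
Variables (to : {action gT &-> T}) (X : {set T}).
Hypothesis nX : [acts G, on X | to].

(* Actions are on the right, and a representation acts on row vectors on the
   right: the row vector f, read as a function on X, is sent by g to
   x |-> f (to x g^-1); see permrepE. *)
Definition permrep_mx (g : gT) : 'M[rat]_#|X| :=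
  \matrix_(i, j) (to (enum_val i) g == enum_val j)%:R.

Lemma permrepE (f : T -> rat) g : g \in G ->
  (\row_i f (enum_val i)) *m permrep_mx g
    = \row_(i < #|X|) f (to (enum_val i) g^-1%g).
Proof.
move=> Gg; apply/rowP=> j; rewrite !mxE.
have Xj : to (enum_val j) g^-1%g \in X.
  by rewrite (acts_act nX) ?groupV // enum_valP.
rewrite (bigD1 (enum_rank_in Xj (to (enum_val j) g^-1%g))) //=.
rewrite !mxE enum_rankK_in // actKV eqxx mulr1 big1 ?addr0 // => i ne_i.
rewrite !mxE; case: eqP => [Eij | _]; last by rewrite mulr0.
by case/eqP: ne_i; apply: enum_val_inj; rewrite enum_rankK_in // -Eij actK.
Qed.

Lemma permrep_repr : mx_repr G permrep_mx.
Proof.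
split=> [|g h Gg Gh].
  apply/matrixP=> i j; rewrite !mxE act1.
  by rewrite (inj_eq enum_val_inj).
apply/matrixP=> i j; rewrite !mxE.
have Xi : to (enum_val i) g \in X by rewrite (acts_act nX) // enum_valP.
rewrite (bigD1 (enum_rank_in Xi (to (enum_val i) g))) //=.
rewrite !mxE enum_rankK_in // eqxx mul1r actM big1 ?addr0 // => l ne_l.
rewrite !mxE; case: eqP => [Eil | _]; last by rewrite mul0r.
by case/eqP: ne_l; apply: enum_val_inj; rewrite enum_rankK_in // Eil.
Qed.

Definition permrep : representation rat G :=
  Representation (MxRepresentation permrep_repr).

End PermutationRepresentation.

(* R^n as a module over O, through red : O -> R. *)
Definition freemod (O : idomainType) (R : finComNzRingType)
  (red : {rmorphism O -> R}) (n : nat) : Type := 'rV[R]_n.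

Section FreeModule.
Variables (O : idomainType) (R : finComNzRingType) (red : {rmorphism O -> R}).
Variable n : nat.
Local Notation F := (freemod red n).

HB.instance Definition _ := Finite.on F.
HB.instance Definition _ := GRing.Zmodule.on F.

Definition freemod_scale (a : O) (v : F) : F := red a *: (v : 'rV[R]_n).

Fact freemod_scaleA a b v :
  freemod_scale a (freemod_scale b v) = freemod_scale (a * b) v.
Proof. by rewrite /freemod_scale scalerA rmorphM. Qed.
Fact freemod_scale1 : left_id 1 freemod_scale.
Proof. by move=> v; rewrite /freemod_scale rmorph1 scale1r. Qed.
Fact freemod_scaleDr : right_distributive freemod_scale +%R.
Proof. by move=> a u v; rewrite /freemod_scale; exact: scalerDr. Qed.
Fact freemod_scaleDl v : {morph freemod_scale^~ v : a b / a + b}.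
Proof. by move=> a b; rewrite /freemod_scale rmorphD; exact: scalerDl. Qed.

HB.instance Definition _ := GRing.Zmodule_isLmodule.Build O F
  freemod_scaleA freemod_scale1 freemod_scaleDr freemod_scaleDl.

(* Aut(F) = GL(n, R), as the group of R-linear permutations of F; the product
   g * h of permutations is "g, then h". *)
Definition autF_set : {set {perm F}} :=
  [set g : {perm F} | [forall a : R, forall u : 'rV[R]_n, forall v : 'rV[R]_n,
     g (a *: u + v) == a *: (g u : 'rV[R]_n) + (g v : 'rV[R]_n)]].

Lemma autFP (g : {perm F}) :
  reflect (forall (a : R) (u v : 'rV[R]_n),
             g (a *: u + v) = a *: (g u : 'rV[R]_n) + (g v : 'rV[R]_n))
          (g \in autF_set).
Proof.
rewrite inE; apply: (iffP forallP) => [H a u v | H a].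
  by apply/eqP; move: (H a) => /forallP/(_ u)/forallP/(_ v).
by apply/forallP=> u; apply/forallP=> v; rewrite H.
Qed.

Lemma autF_group_set : group_set autF_set.
Proof.
apply/group_setP; split=> [|g h /autFP Hg /autFP Hh]; apply/autFP=> a u v.
  by rewrite !perm1.
by rewrite !permM Hg Hh.
Qed.
Canonical autF := Group autF_group_set.

Variable P : O -> Prop.

Definition submods (la : seq nat) : {set {set F}} :=
  [set x : {set F} | `[< submod_type P (fun v => v \in x) la >]].

Lemma submods_acts la : [acts autF, on submods la | ('P^*)%act].
Proof.
have sub g : g \in autF -> forall x, x \in submods la ->
    ('P^*)%act x g \in submods la.
  move=> /autFP lin_g x; rewrite !inE => /asboolP[f [imf kerf]].
  apply/asboolP.
  have g0 : g 0 = 0.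
    by have := lin_g (- 1) 0 0; rewrite !scaleN1r !addNr.
  have lin_gf : linear (fun a => g (f a)).
    by move=> a u v; rewrite linearP; exact: lin_g.
  pose gf_lin := GRing.isLinear.Build _ _ _ _ (fun a => g (f a)) lin_gf.
  pose gf : {linear 'rV[O]_(size la) -> F} := HB.pack (fun a => g (f a)) gf_lin.
  exists gf; split=> [v|a].
    split=> [/imsetP[w /imf[a ->] ->] | [a ->]]; first by exists a.
    by apply/imsetP; exists (f a); rewrite ?imf //; exists a.
  rewrite -kerf /=; split=> [gfa | ->]; last exact: g0.
  by apply: (@perm_inj _ g); rewrite g0.
apply/actsP=> g Gg x; apply/idP/idP; last exact: sub.
by move/(sub _ (groupVr Gg)); rewrite actK.
Qed.

(* The space of rational functions on the submodules of type la. *)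
Definition funrep (la : seq nat) : representation rat autF :=
  permrep (submods_acts la).

End FreeModule.

(* The irreducible representation U occurs in V with multiplicity exactly a:
   V is isomorphic to a copies of U plus a complement W which has no
   subrepresentation isomorphic to U. *)
Definition multiplicity (gT : finGroupType) (G : {group gT})
    (U V : representation rat G) (a : nat) :=
  exists2 W : representation rat G,
    mx_rsim V (dadd_grepr (muln_grepr U a) W) &
    forall (A : 'M_(rdegree W)) (modA : mxmodule W A),
      ~ mx_rsim U (submod_repr modA).

(* Main.v *)
Require Import Defs.
From HB Require Import structures.
From mathcomp Require Import all_boot all_order all_algebra all_fingroup.
From mathcomp Require Import pgroup mxrepresentation character.
From mathcomp Require Import boolp.
Set Implicit Arguments.
Unset Strict Implicit.
Unset Printing Implicit Defensive.
Import GroupScope GRing.Theory.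
Local Open Scope ring_scope.

(** Why the theorem holds.  Write F for the free module of rank n over the
    quotient ring, G for its automorphism group, pi for a uniformizer and X for
    the set of free submodules of F of rank m.

    Module theory enters through one extension lemma, [extend_into_divisible]: a
    linear map with prescribed kernel from a submodule of M into a module that is
    injective for the exponent k extends to M with the same kernel, as soon as a
    count of socles allows it; one element is adjoined at a time.  It implies
    that isomorphisms between submodules of F extend to elements of G
    ([extend_to_perm]), so that the G-orbits of submodules are the types; that
    the pointwise stabilizer of d is transitive on the members of X above d
    ([iso_above]); and, since 2 m <= n, that every submodule d of y0 in X is
    the intersection of y0 with some y in X ([cap_above]).

    For a submodule d let e_d be the function on X with e_d(y) = 1 if d is
    contained in y, and 0 otherwise.  Let D be a set of submodules closed under G
    and under passage to submodules, let V_D be the span of the e_d for d in D,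
    let w be a submodule of y0, and H its stabilizer.  The central fact,
    [rank_orbit_sum_span], is that the space of H-fixed vectors of V_D has a
    basis formed by the sums of the e_d over the H-orbits of those d in D that
    are contained in w.  Indeed the e_d with d contained in w are linearly
    independent, since each such d is w :&: y for some y in X.  They span: if z
    is in D and d is the intersection of w and z, then the sum of the translates
    of e_z under the pointwise stabilizer of d is a multiple of e_d; the
    translates z' of z with w :&: z' = d form one orbit under the pointwise
    stabilizer of w, and the others meet w in a larger submodule, so that
    induction applies to them.

    Let x be a submodule of y0 of type la.  The representation U_la is a
    complement of the span of the e_d with d smaller than x in the span of these
    and of the e_d with d of type la.  By the central fact the H-fixed vectors of
    U_la have dimension the number of H-orbits on the submodules of w of type la.
    For w = y0 this number is 1; as every nonzero invariant space of functions on
    X has a nonzero vector fixed by the stabilizer of y0, U_la is irreducible,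
    and its endomorphisms are the scalars.  By Frobenius reciprocity
    ([permrep_hom_dim]) the multiplicity of U_la in the functions on the orbit of
    w is the same number of H-orbits, which counts the classes of embeddings of
    la in the type of w ([emb_classes_orbits]).  In particular, if U_la and U_mu
    are isomorphic then each of la and mu embeds in the other, hence la = mu.  So
    the sum of the U_la is direct, and it is the whole space of functions on X
    because it contains every e_d, by induction on the size of d. *)

(** * Multiplicities and dimensions of spaces of intertwiners *)

Section Intertwiners.
Variables (gT : finGroupType) (G : {group gT}).
Local Notation rep := (representation rat G).
Implicit Types U V W : rep.

(** M is a G-homomorphism from V to U, acting on row vectors on the right. *)
Definition intertwiner V U (M : 'M_(rdegree V, rdegree U)) :=
  forall g, g \in G -> V g *m M = M *m U g.
Arguments intertwiner : clear implicits.

(** The space of G-homomorphisms from V to U has dimension a; the dimension is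
    witnessed by a linear bijection from row vectors of size a. *)
Definition hom_dim V U a :=
  exists phi : 'rV[rat]_a -> 'M_(rdegree V, rdegree U),
    [/\ linear phi, injective phi &
        forall M, intertwiner V U M <-> exists c, M = phi c].

Lemma hom_dim_le V U a b : hom_dim V U a -> hom_dim V U b -> (a <= b)%N.
Proof.
case=> f [linf injf homf] [h [linh injh homh]].
have fS (x : 'rV_a) : exists c, f x = h c.
  by apply/homh/homf; exists x.
have [C fC] : exists C : 'M_(a, b), forall i, f (row i 1%:M) = h (row i C).
  have [c fc] := choice (fun i : 'I_a => fS (row i 1%:M)).
  by exists (\matrix_i c i) => i; rewrite rowK.
pose f' : {linear _ -> _} := HB.pack f (GRing.isLinear.Build _ _ _ _ f linf).
pose h' : {linear _ -> _} := HB.pack h (GRing.isLinear.Build _ _ _ _ h linh).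
have fE x : f x = h (x *m C).
  rewrite -[x in f x]mulmx1 !mulmx_sum_row -[f _]/(f' _) -[h _]/(h' _).
  rewrite !linear_sum; apply: eq_bigr => i _; rewrite !linearZ /=.
  by rewrite fC.
suff /eqP <- : row_free C by rewrite rank_leq_col.
rewrite -kermx_eq0; apply/rowV0P=> v /sub_kermxP vC0.
apply: injf; rewrite fE vC0 -[h _]/(h' _) -[f _]/(f' _).
by rewrite !linear0.
Qed.

Lemma hom_dim_uniq V U a b : hom_dim V U a -> hom_dim V U b -> a = b.
Proof. by move=> ha hb; apply/eqP; rewrite eqn_leq !(@hom_dim_le V U). Qed.

Lemma hom_dim_rsim V V' U a : mx_rsim V V' -> hom_dim V' U a -> hom_dim V U a.
Proof.
case: V V' => nV V [nV' V'] [B /= def_n]; subst nV' => freeB homB.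
have uB : B \in unitmx by rewrite -row_free_unit.
case=> f /= [linf injf homf]; exists (fun c => B *m f c); split=> /=.
- by move=> a' u v; rewrite linf mulmxDr scalemxAr.
- by move=> u v /(can_inj (mulKmx uB)) /injf.
move=> M; split=> [homM | [c ->] g Gg]; last first.
  have /homf homc : exists c', f c = f c' by exists c.
  by rewrite mulmxA homB // -mulmxA homc //= mulmxA.
have /homf [c Ec] : intertwiner (Representation V') U (invmx B *m M).
  move=> g Gg /=; rewrite mulmxA; apply: (can_inj (mulKmx uB)).
  by rewrite !mulmxA -homB // mulmxK // mulmxV // mul1mx homM.
by exists c; rewrite -Ec mulKVmx.
Qed.

Lemma hom_dim_dadd V1 V2 U a b :
  hom_dim V1 U a -> hom_dim V2 U b -> hom_dim (dadd_grepr V1 V2) U (a + b).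
Proof.
case: V1 V2 => n1 V1 [n2 V2] [f1 /= [lin1 inj1 hom1]] [f2 /= [lin2 inj2 hom2]].
exists (fun c => col_mx (f1 (lsubmx c)) (f2 (rsubmx c))); split=> /=.
- move=> x u v; rewrite !linearP /= lin1 lin2.
  by rewrite scale_col_mx add_col_mx.
- move=> u v /eq_col_mx[/inj1 El /inj2 Er].
  by rewrite -[u]hsubmxK El Er hsubmxK.
move=> M; split=> [homM | [c ->] g Gg /=]; last first.
  rewrite mul_block_col mul_col_mx !mul0mx addr0 add0r.
  by congr col_mx; [apply: (hom1 _).2 => // | apply: (hom2 _).2 => //];
     eexists.
rewrite -[M]vsubmxK in homM *.
have homs g : g \in G -> _ := fun Gg => homM g Gg.
have [c1 E1] : exists c, usubmx M = f1 c.
  apply/hom1=> g /homs /=; rewrite mul_block_col mul_col_mx !mul0mx addr0 add0r.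
  by case/eq_col_mx.
have [c2 E2] : exists c, dsubmx M = f2 c.
  apply/hom2=> g /homs /=; rewrite mul_block_col mul_col_mx !mul0mx addr0 add0r.
  by case/eq_col_mx.
by exists (row_mx c1 c2); rewrite row_mxKl row_mxKr E1 E2.
Qed.

Lemma dadd_greprA V1 V2 V3 :
  mx_rsim (dadd_grepr V1 (dadd_grepr V2 V3)) (dadd_grepr (dadd_grepr V1 V2) V3).
Proof.
case: V1 V2 V3 => n1 V1 [n2 V2] [n3 V3] /=.
have /= := @block_mxAx rat n1 n2 n3 n1 n2 n3.
move: (addnA n1 n2 n3) => e blockA.
exists (castmx (erefl, e) 1%:M) => //=.
  rewrite -row_leq_rank; case: _ / e {blockA} => /=.
  by rewrite castmx_id mxrank1.
move=> g Gg; have := blockA (V1 g) 0 0 0 (V2 g) 0 0 0 (V3 g).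
rewrite row_mx0 !col_mx0 row_mx0 => ->.
case: _ / e {blockA} (block_mx (block_mx _ _ _ _) _ _ _) => /= A.
by rewrite !castmx_id mulmx1 mul1mx.
Qed.

Lemma dadd_grepr_rsimr V1 V2 V2' :
  mx_rsim V2 V2' -> mx_rsim (dadd_grepr V1 V2) (dadd_grepr V1 V2').
Proof.
case: V1 V2 V2' => n1 V1 [n2 V2] [n2' V2'] [B /= e fB homB]; subst n2'.
exists (block_mx 1%:M 0 0 B) => //= [|g Gg].
  rewrite row_free_unit unitmxE det_ublock det1 mul1r -unitmxE.
  by rewrite -row_free_unit.
by rewrite !mulmx_block !(mulmx0, mul0mx, mulmx1, mul1mx, addr0, add0r) homB.
Qed.

Lemma dadd_grepr0 V : mx_rsim (dadd_grepr grepr0 V) V.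
Proof.
case: V => n V /=; exists (col_mx 0 1%:M) => //= [|g Gg].
  apply/row_freeP; exists (row_mx 0 1%:M).
  rewrite mul_col_mx mul0mx mul1mx [RHS](scalar_mx_block 0 n).
  by rewrite /block_mx; congr col_mx; rewrite [RHS]flatmx0.
rewrite mul_block_col mul_col_mx !mul0mx !mulmx1 mul1mx addr0 mulmx0.
by rewrite add0r.
Qed.

Lemma rat_pchar' : [pchar rat]^'.-group G.
Proof.
apply/pgroupP=> p p_pr _; rewrite inE /= inE /= negb_and p_pr /=.
by rewrite Num.Theory.pnatr_eq0 -lt0n prime_gt0.
Qed.

(** A nonzero homomorphism into an irreducible U splits off a copy of U: a
    complement of its kernel. *)
Lemma rsim_of_intertwiner V U M : mx_irreducible U -> intertwiner V U M ->
  M != 0 -> exists A (modA : mxmodule V A), mx_rsim U (submod_repr modA).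
Proof.
move=> irrU homM nzM.
have [n_gt0 simU] := (mx_irrP U).1 irrU.
have modK : mxmodule V (kermx M).
  apply/mxmoduleP=> g Gg; apply/sub_kermxP.
  by rewrite -mulmxA homM // mulmxA mulmx_ker mul0mx.
have [A modA defV dxV] := mx_Maschke_pchar V rat_pchar' modK (submx1 _).
exists A, modA; apply: mx_rsim_sym.
have fullM : row_full M.
  rewrite /row_full -(genmxE M); apply: simU.
    rewrite (eqmx_module _ (genmxE _)); apply/mxmoduleP=> g Gg.
    by rewrite -homM // submxMl.
  by rewrite (eqmx_eq0 (genmxE _)).
have rkA : \rank A = rdegree U.
  have := mxdirectP dxV; rewrite /= defV mxrank1 mxrank_ker (eqP fullM).
  move/eqP; rewrite -{1}(subnK (rank_leq_row M)) (eqP fullM) eqn_add2l.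
  by move/eqP.
exists (val_submod 1%:M *m M) => // [|g Gg].
  apply/eqP; have := mxrank_mul_ker (val_submod (1%:M : 'M_(\rank A))) M.
  have /eqP -> : \rank (val_submod (1%:M : 'M_(\rank A)) :&: kermx M)%MS == 0%N.
    rewrite mxrank_eq0 -submx0 -(mxdirect_addsP dxV) sub_capmx capmxSr.
    by rewrite (submx_trans (capmxSl _ _)) // val_submodP.
  by rewrite addn0 val_submod1.
rewrite mulmxA -val_submodE -[submod_repr _ g]mul1mx val_submodJ //.
by rewrite -!mulmxA homM.
Qed.

Lemma hom_dim0 V U : mx_irreducible U ->
    (forall A (modA : mxmodule V A), ~ mx_rsim U (submod_repr modA)) ->
  hom_dim V U 0.
Proof.
move=> irrU noU; exists (fun=> 0); split=> //.
- by move=> a u v; rewrite scaler0 addr0.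
- by move=> u v _; apply/rowP; case.
move=> M; split=> [homM | [_ ->] g Gg]; last by rewrite mulmx0 mul0mx.
exists 0; apply/eqP/idPn=> nzM.
by have [A [modA /noU]] := rsim_of_intertwiner irrU homM nzM.
Qed.

(** Copies of U are split off V one at a time, and each of them contributes one
    dimension to the space of homomorphisms. *)
Theorem multiplicity_exists U V : mx_irreducible U -> hom_dim U U 1 ->
  exists2 a, multiplicity U V a & hom_dim V U a.
Proof.
move=> irrU homU.
have [d] := ubnP (rdegree V); elim: d V => // d IHd V /ltnSE leVd.
case: (pselect (exists A (modA : mxmodule V A), mx_rsim U (submod_repr modA))).
  move=> [A [modA simA]].
  have [B modB defV dxV] := mx_Maschke_pchar V rat_pchar' modA (submx1 _).
  have [n_gt0 _] := (mx_irrP U).1 irrU.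
  pose V' := Representation (submod_repr modB).
  have ltV' : (rdegree V' < d)%N.
    apply: leq_trans leVd; have := mxdirectP dxV.
    rewrite /= defV mxrank1 -(mxrank_rsim simA) => rkV.
    by rewrite [ltnRHS]rkV -add1n leq_add2r.
  have simV : mx_rsim V (dadd_grepr U V').
    apply: mx_rsim_trans (mx_rsim_sym (rsim_submod1 (mxmodule1 V) _)) _ => //.
    apply: mx_rsim_dadd defV dxV _ _; first exact: mx_rsim_sym.
    exact: mx_rsim_refl.
  have [a [W simV' noU] homV'] := IHd V' ltV'.
  exists a.+1; last first.
    by apply: hom_dim_rsim simV _; apply: (hom_dim_dadd homU homV').
  exists W => //; apply: mx_rsim_trans simV _.
  rewrite /muln_grepr big_ord_recl.
  exact: mx_rsim_trans (dadd_grepr_rsimr _ simV') (dadd_greprA _ _ _).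
move=> noU; have {}noU A (modA : mxmodule V A) : ~ mx_rsim U (submod_repr modA).
  by move=> simA; apply: noU; exists A, modA.
exists 0%N; last exact: hom_dim0.
exists V => //; rewrite /muln_grepr big_ord0; apply: mx_rsim_sym.
exact: dadd_grepr0.
Qed.

Lemma multiplicity_hom_dim U V a : mx_irreducible U -> hom_dim U U 1 ->
  hom_dim V U a -> multiplicity U V a.
Proof.
move=> irrU homU homV; have [b mulb homb] := multiplicity_exists V irrU homU.
by rewrite (hom_dim_uniq homV homb).
Qed.

(** An endomorphism preserves the line fixed by H, hence it has an eigenvalue,
    and Schur's lemma applies. *)
Lemma hom_dim_self U (H : {set gT}) : mx_irreducible U -> H \subset G ->
  \rank (rfix_mx U H) = 1%N -> hom_dim U U 1.
Proof.
move=> irrU sHG rk1; exists (fun c => (c 0 0)%:M); split.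
- by move=> a u v; rewrite !mxE raddfD /= -scale_scalar_mx.
- move=> u v E; apply/rowP=> i; rewrite ord1.
  have [n_gt0 _] := (mx_irrP U).1 irrU.
  case: (rdegree U) n_gt0 E => // n _ /matrixP/(_ 0 0).
  by rewrite !mxE eqxx.
move=> M; split=> [homM | [c ->] g Gg]; last first.
  by rewrite -scalar_mxC.
set F := rfix_mx U H in rk1.
have [u defF] : exists u : 'rV_(rdegree U), (F :=: u)%MS.
  have := eq_row_base F; move: (row_base F); rewrite rk1 => u Eu.
  by exists u; apply: eqmx_sym.
have nzu : u != 0 by rewrite -mxrank_eq0 -defF rk1.
have : (u *m M <= F)%MS.
  apply/rfix_mxP=> g Hg; have Gg := subsetP sHG g Hg.
  by rewrite -mulmxA -homM // mulmxA (rfix_mxP H _) // defF.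
rewrite defF => /sub_rVP[c Ec].
exists (const_mx c); rewrite mxE; apply/eqP; rewrite -subr_eq0.
apply: contraTT nzu => nz; rewrite negbK -(mulmx1 u).
have unitMc : M - c%:M \in unitmx.
  apply: (mx_Schur irrU) => //; apply/centgmxP=> g Gg.
  by rewrite mulmxBl mulmxBr homM // -scalar_mxC.
rewrite -(mulmxV unitMc) mulmxA mulmxBr Ec -mul_mx_scalar subrr.
by rewrite mul0mx.
Qed.

End Intertwiners.

(** * Frobenius reciprocity and fixed vectors *)

Section Frobenius.
Variables (gT : finGroupType) (G : {group gT}) (T : finType).
Variables (to : {action gT &-> T}) (X : {set T}).
Hypothesis nX : [acts G, on X | to].

Lemma permrep_row n (M : 'M[rat]_(#|X|, n)) x (Xx : x \in X) g y (Yy : y \in X) :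
  g \in G -> y = to x g ->
  row (enum_rank_in Xx x) (permrep_mx to X g *m M) = row (enum_rank_in Yy y) M.
Proof.
move=> Gg Ey; rewrite row_mul (_ : row _ _ = delta_mx 0 (enum_rank_in Yy y)).
  by rewrite -rowE.
apply/rowP=> j; rewrite !mxE eqxx /= enum_rankK_in // -Ey.
congr (_ %:R); congr nat_of_bool; apply/eqP/eqP=> [E|->].
  by rewrite [X in enum_rank_in Yy X]E enum_valK_in.
by rewrite enum_rankK_in.
Qed.

(** Frobenius reciprocity: an intertwiner from the functions on an orbit is
    determined by the image of the point mass at w, which may be any vector fixed
    by the stabilizer of w. *)
Lemma permrep_hom_dim (U : representation rat G) w :
    X = orbit to G w ->
  hom_dim (permrep nX) U (\rank (rfix_mx U 'C_G[w | to])).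
Proof.
move=> EX; set H := 'C_G[w | to]; set B := row_base (rfix_mx U H).
have Xw : w \in X by rewrite EX orbit_refl.
have [t tP] : exists t : T -> gT, forall x, x \in X -> t x \in G /\ to w (t x) = x.
  have /choice[t tP] x : exists g, x \in X -> g \in G /\ to w g = x.
    case Xx: (x \in X); last by exists 1%g.
    by move: Xx; rewrite EX => /orbitP[g Gg Eg]; exists g.
  by exists t.
have BH h : h \in H -> B *m U h = B.
  by move=> Hh; apply: (rfix_mxP H _) h Hh; rewrite eq_row_base.
pose phi (c : 'rV_(\rank (rfix_mx U H))) : 'M_(#|X|, rdegree U) :=
  \matrix_i (c *m B *m U (t (enum_val i))).
have phi_row c x (Xx : x \in X) :
    row (enum_rank_in Xx x) (phi c) = c *m B *m U (t x).
  by rewrite rowK enum_rankK_in.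
exists phi; split=> /=.
- move=> a u v; apply/row_matrixP=> i; rewrite [RHS]linearP /phi /= !rowK.
  by rewrite !mulmxDl -!scalemxAl.
- move=> u v E; have := phi_row u w Xw; rewrite E phi_row.
  have [/(repr_mx_free U) Gt _] := tP w Xw.
  move/(row_free_inj Gt)/row_free_inj => -> //; exact: row_base_free.
move=> M; split=> [homM | [c ->] g Gg].
  set r := row (enum_rank_in Xw w) M.
  have rX x (Xx : x \in X) : row (enum_rank_in Xx x) M = r *m U (t x).
    have [Gt Et] := tP x Xx; rewrite -row_mul -homM //.
    by rewrite (permrep_row M Xw Xx).
  have : (r <= B)%MS.
    rewrite eq_row_base; apply/rfix_mxP=> h /setIP[Gh /astab1P Eh].
    by rewrite -row_mul -homM // (permrep_row M Xw Xw).
  case/submxP=> c Ec; exists c; apply/row_matrixP=> i; rewrite rowK -Ec.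
  have Xi := enum_valP i.
  by rewrite -(rX _ Xi) enum_valK_in.
apply/row_matrixP=> i; have Xi := enum_valP i.
have Xig : to (enum_val i) g \in X by rewrite (acts_act nX).
rewrite -[i](enum_valK_in Xi) (permrep_row _ Xi Xig) // phi_row row_mul phi_row.
have [Gt Et] := tP _ Xi; have [Gtg Etg] := tP _ Xig.
have Hs : (t (enum_val i) * g * (t (to (enum_val i) g))^-1)%g \in H.
  apply/setIP; split; first by rewrite !groupM ?groupV.
  apply/astab1P.
  by rewrite !actM Et; apply: (canLR (actK to _)); rewrite Etg.
rewrite -[in LHS](BH _ Hs) !repr_mxM ?groupM ?groupV //.
by rewrite !mulmxA repr_mxKV.
Qed.

End Frobenius.

Section FixedVectors.
Variables (gT : finGroupType) (G H : {group gT}) (U : representation rat G).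
Hypothesis sHG : H \subset G.

(** Summation over H; up to the factor #|H|, the projection on the H-fixed
    vectors. *)
Definition orbit_sum := \sum_(h in H) U h.

Lemma orbit_sumJ h : h \in H -> U h *m orbit_sum = orbit_sum.
Proof.
move=> Hh; rewrite mulmx_sumr /orbit_sum [RHS](reindex_inj (mulgI h)) /=.
apply: eq_big => [g | g Hg]; first by rewrite groupMl.
by rewrite repr_mxM ?(subsetP sHG).
Qed.

Lemma orbit_sumV h : h \in H -> orbit_sum *m U h = orbit_sum.
Proof.
move=> Hh; rewrite mulmx_suml /orbit_sum [RHS](reindex_inj (mulIg h)) /=.
apply: eq_big => [g | g Hg]; first by rewrite groupMr.
by rewrite repr_mxM ?(subsetP sHG).
Qed.

Lemma cap_rfix m (A : 'M_(m, rdegree U)) :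
  mxmodule U A -> (A :&: rfix_mx U H :=: A *m orbit_sum)%MS.
Proof.
move=> modA; apply/eqmxP/andP; split.
  set W := (_ :&: _)%MS; have fixW h : h \in H -> W *m U h = W.
    by apply: (rfix_mxP H _); rewrite capmxSr.
  have : W *m orbit_sum = #|H|%:R *: W.
    rewrite mulmx_sumr (eq_bigr (fun=> W)) // sumr_const scaler_nat //.
  move=> E; have nz : (#|H|%:R : rat) != 0.
    by rewrite Num.Theory.pnatr_eq0 -lt0n cardG_gt0.
  by rewrite -(eqmx_scale _ nz) -E submxMr // capmxSl.
rewrite sub_capmx; apply/andP; split.
  rewrite mulmx_sumr summx_sub // => h Hh.
  exact: (mxmoduleP modA) (subsetP sHG _ Hh).
by apply/rfix_mxP=> h Hh; rewrite -mulmxA orbit_sumV.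
Qed.

Lemma rank_rfix_submod (A : 'M_(rdegree U)) (modA : mxmodule U A) :
  \rank (rfix_mx (submod_repr modA) H) = \rank (A *m orbit_sum).
Proof.
by rewrite rfix_submod // mxrank_in_submod ?capmxSl // cap_rfix.
Qed.

Lemma rank_orbit_sum_direct (A B C : 'M_(rdegree U)) :
    mxmodule U A -> mxmodule U B -> (A + B :=: C)%MS -> (A :&: B = 0)%MS ->
  \rank (C *m orbit_sum) = (\rank (A *m orbit_sum) + \rank (B *m orbit_sum))%N.
Proof.
move=> modA modB defC tiAB.
rewrite -(eqmxMr _ defC) addsmxMr mxrank_disjoint_sum //.
apply/eqP; rewrite -submx0 -tiAB.
by apply: capmxS; rewrite -cap_rfix // capmxSl.
Qed.

End FixedVectors.

(** * Incidence vectors and their orbit sums *)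

Lemma subset_setact (F : finType) (g : {perm F}) (d y : {set F}) :
  (('P^*)%act d g \subset ('P^*)%act y g) = (d \subset y).
Proof.
have sub h (a b : {set F}) : a \subset b -> ('P^*)%act a h \subset ('P^*)%act b h.
  exact: imsetS.
by apply/idP/idP=> /sub // /(_ g^-1)%g; rewrite !actK.
Qed.

Section Incidence.
Variables (F : finType) (G : {group {perm F}}) (X S : {set {set F}}).
Hypothesis nX : [acts G, on X | 'P^*].
Local Notation act d g := (('P^*)%act d g).
Local Notation rX := (permrep nX).

(* S stands for the submodules of F, and X for the free ones of rank m *)
Hypothesis capS : forall d d', d \in S -> d' \in S -> d :&: d' \in S.
Hypothesis actS : forall d g, d \in S -> g \in G -> act d g \in S.
Hypothesis above_trans : forall d y y', d \in S -> y \in X -> y' \in X ->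
  d \subset y -> d \subset y' -> exists2 g, g \in 'C_G(d | 'P) & act y g = y'.
Hypothesis glue : forall w z g, w \in S -> z \in S -> g \in 'C_G(w :&: z | 'P) ->
  w :&: act z g = w :&: z -> exists2 k, k \in 'C_G(w | 'P) & act z k = act z g.

(** The function on X that takes the value 1 at the y containing d, and 0
    elsewhere. *)
Definition incidence (d : {set F}) : 'rV[rat]_(rdegree rX) :=
  \row_(i < #|X|) (d \subset enum_val i)%:R.

Lemma incidenceJ d g : g \in G -> incidence d *m rX g = incidence (act d g).
Proof.
move=> Gg; have := permrepE nX (fun y : {set F} => (d \subset y)%:R) Gg.
move=> /= ->; apply/rowP=> i; rewrite !mxE.
by rewrite -(subset_setact g d) actKV.
Qed.

Lemma incidence0 (d : {set F}) :
  (forall y, y \in X -> ~~ (d \subset y)) -> incidence d = 0.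
Proof.
by move=> nd; apply/rowP=> i; rewrite !mxE (negbTE (nd _ (enum_valP i))).
Qed.

Lemma sub_astab_act (d : {set F}) g : g \in 'C(d | 'P) -> act d g = d.
Proof.
move/astabP=> fix_d; rewrite -[RHS]imset_id; apply: eq_in_imset => x dx.
exact: fix_d.
Qed.

(** The coefficient M counts the translates of z contained in a given y above d;
    it does not depend on y by transitivity. *)
Lemma sum_incidence (d z : {set F}) : d \in S -> d \subset z ->
  exists M : rat, \sum_(g in 'C_G(d | 'P)) incidence (act z g) = M *: incidence d.
Proof.
move=> Sd dz; set K := 'C_G(d | 'P).
have [/existsP[y0 /andP[Xy0 dy0]] | no_y] :=
    boolP [exists y, (y \in X) && (d \subset y)]; last first.
  exists 0; rewrite scale0r big1 // => g /setIP[_ Kg]; apply: incidence0 => y Xy.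
  apply: contra no_y => zy; apply/existsP; exists y; rewrite Xy /=.
  by apply: subset_trans zy; rewrite -(sub_astab_act Kg) subset_setact.
exists (\sum_(g in K) (act z g \subset y0)%:R).
apply/rowP=> i; rewrite summxE !mxE; set y := enum_val i.
have Xy : y \in X by apply: enum_valP.
case dy: (d \subset y); last first.
  rewrite mulr0 big1 // => g /setIP[_ Kg]; rewrite !mxE.
  case zy: (act z g \subset _) => //; move: dy; rewrite -/y in zy.
  suff -> : d \subset y by [].
  by apply: subset_trans zy; rewrite -(sub_astab_act Kg) subset_setact.
have [k Kk Ey] := above_trans Sd Xy0 Xy dy0 dy.
rewrite mulr1 (reindex_inj (mulIg k)) /=; apply: eq_big => [g | g Kg].
  by rewrite groupMr.
by rewrite !mxE actM -/y -Ey subset_setact.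
Qed.

Section Downset.
Variable D : {set {set F}}.
Hypothesis sDS : D \subset S.
Hypothesis actD : forall d g, d \in D -> g \in G -> act d g \in D.
Hypothesis subD : forall d z : {set F},
  z \in D -> d \in S -> d \subset z -> d \in D.

(** The invariant space spanned by the incidence vectors of the members of D. *)
Definition span_incidence : 'M[rat]_(rdegree rX) :=
  (\sum_(d in D) <<incidence d>>)%MS.

Lemma span_incidence_sub m (B : 'M_(m, rdegree rX)) :
  (forall d, d \in D -> (incidence d <= B)%MS) -> (span_incidence <= B)%MS.
Proof. by move=> sDB; apply/sumsmx_subP=> d Dd; rewrite genmxE sDB. Qed.

Lemma incidence_span d : d \in D -> (incidence d <= span_incidence)%MS.
Proof.
by move=> Dd; apply: (sumsmx_sup d) => //; rewrite genmxE.
Qed.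

Lemma span_incidence_module : mxmodule rX span_incidence.
Proof.
apply/mxmoduleP=> g Gg; rewrite sumsmxMr; apply/sumsmx_subP=> d Dd.
by rewrite (eqmxMr _ (genmxE _)) incidenceJ // incidence_span // actD.
Qed.

Variable w : {set F}.
Hypothesis Sw : w \in S.
Let H := 'C_G[w | 'P^*]%G.
Local Notation sumH := (orbit_sum H rX).

Lemma sub_fix_w : 'C_G(w | 'P) \subset H.
Proof.
apply/subsetP=> g /setIP[Gg Cg]; apply/setIP; split=> //.
by apply/astab1P; exact: sub_astab_act.
Qed.

Lemma sHG : H \subset G. Proof. exact: subsetIl. Qed.

Lemma incidence_sumJ d h : h \in H ->
  incidence (act d h) *m sumH = incidence d *m sumH.
Proof.
move=> Hh; rewrite -incidenceJ ?(subsetP sHG) // -mulmxA.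
by rewrite (orbit_sumJ _ sHG).
Qed.

(** The orbit sum of any member of D is a combination of orbit sums of members of
    D contained in w, by induction on the size of w :&: z. *)
Lemma orbit_sum_incidence m (B : 'M_(m, rdegree rX)) :
    (forall d, d \in D -> d \subset w -> (incidence d *m sumH <= B)%MS) ->
  forall z, z \in D -> (incidence z *m sumH <= B)%MS.
Proof.
move=> DB z; have [j] := ubnP (#|w| - #|w :&: z|)%N.
elim: j z => // j IHj z /ltnSE lej Dz.
have Sz := subsetP sDS z Dz; pose d := w :&: z.
have Sd : d \in S by apply: capS.
have Dd : d \in D by apply: subD Dz Sd (subsetIr _ _).
have [M EM] := sum_incidence Sd (subsetIr w z); set K := 'C_G(d | 'P) in EM.
have : ((\sum_(g in K) incidence (act z g)) *m sumH <= B)%MS.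
  by rewrite EM -scalemxAl scalemx_sub // DB ?subsetIl.
(* the translates meeting w exactly in d are conjugate to z under the pointwise
   stabilizer of w, hence have the same orbit sum; the others meet w in a larger
   submodule *)
rewrite mulmx_suml (bigID (fun g => w :&: act z g == d)) /=.
rewrite (eq_bigr (fun=> incidence z *m sumH)); last first.
  move=> g /andP[Kg /eqP Eg]; have [k Ck <-] := glue Sw Sz Kg Eg.
  by rewrite incidence_sumJ // (subsetP sub_fix_w).
rewrite sumr_const -scaler_nat; set N := #|_|; set R := \sum_(g in K | _) _.
have sRB : (R <= B)%MS.
  apply: summx_sub => g /andP[Kg ne_g]; have /setIP[Gg Cg] := Kg.
  apply: IHj; last exact: actD.
  have lt_d : d \proper w :&: act z g.
    rewrite properEneq eq_sym ne_g subsetI subsetIl /=.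
    by rewrite -(sub_astab_act Cg) subset_setact subsetIr.
  apply: leq_trans lej; apply: ltn_sub2l; last exact: proper_card.
  exact: leq_trans (proper_card lt_d) (subset_leq_card (subsetIl _ _)).
rewrite addrC => sumB; have nzN : (N%:R : rat) != 0.
  rewrite Num.Theory.pnatr_eq0 -lt0n; apply/card_gt0P; exists 1%g.
  by rewrite unfold_in /= group1 act1 eqxx.
rewrite -(eqmx_scale _ nzN) -[_ *: _](addKr R) addmx_sub // eqmx_opp //.
Qed.

Hypothesis above_w : forall d : {set F}, d \in S -> d \subset w ->
  exists2 y, y \in X & w :&: y = d.

Let Dw := [set d in D | d \subset w].

(** Evaluating at some y with w :&: y = d leaves the coefficient of d and those
    of smaller submodules. *)
Lemma incidence_free (a : {set F} -> rat) :
  \sum_(d in Dw) a d *: incidence d = 0 -> forall d, d \in Dw -> a d = 0.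
Proof.
move=> sum0 d; have [j] := ubnP #|d|; elim: j d => // j IHj d /ltnSE lej Dwd.
have [Dd dw] : d \in D /\ d \subset w by move: Dwd; rewrite inE => /andP[].
have [y Xy Ed] := above_w (subsetP sDS d Dd) dw.
have := congr1 (fun v : 'rV_#|X| => v 0 (enum_rank_in Xy y)) sum0.
rewrite /= summxE mxE (bigD1 d) //= !mxE enum_rankK_in //.
rewrite -{2}Ed subsetIr mulr1 big1 ?addr0 // => d' /andP[Dwd' ne_d].
rewrite !mxE enum_rankK_in //; case d'y: (d' \subset y); last by rewrite mulr0.
rewrite IHj ?mul0r //; apply: leq_trans lej; apply: proper_card.
rewrite properEneq ne_d -Ed subsetI d'y andbT.
by move: Dwd'; rewrite inE => /andP[].
Qed.

Lemma act_Dw d h : h \in H -> d \in Dw -> act d h \in Dw.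
Proof.
case/setIP=> Gh /astab1P Ew; rewrite !inE => /andP[Dd dw].
by rewrite actD //= -[in X in _ \subset X]Ew subset_setact.
Qed.

Let orbs := orbit 'P^* H @: Dw.
(* a chosen member of an orbit *)
Let repo (o : {set {set F}}) : {set F} := odflt set0 [pick d in o].

Lemma repoP d : d \in Dw -> let o := orbit 'P^* H d in
  exists2 h, h \in H & repo o = act d h.
Proof.
move=> Dwd o; rewrite /repo; case: pickP => [d' /orbitP[h Hh <-] | no].
  by exists h.
by have := no d; rewrite orbit_refl.
Qed.

(** The orbit sums of the members of D contained in w form a basis of the space
    of fixed vectors. *)
Lemma rank_orbit_sum_span : \rank (span_incidence *m sumH) = #|orbs|.
Proof.
pose B := \matrix_(i < #|orbs|) (incidence (repo (enum_val i)) *m sumH).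
have rowB d (Dwd : d \in Dw) :
    row (enum_rank_in (imset_f _ Dwd) (orbit 'P^* H d)) B = incidence d *m sumH.
  rewrite rowK enum_rankK_in ?imset_f //.
  by have [h Hh ->] := repoP Dwd; rewrite incidence_sumJ.
have repD i : repo (enum_val (i : 'I_#|orbs|)) \in Dw.
  have /imsetP[d Dwd ->] := enum_valP i.
  by have [h Hh ->] := repoP Dwd; apply: act_Dw.
have -> : \rank (span_incidence *m sumH) = \rank B.
  apply: eqmx_rank; apply/andP; split.
    rewrite sumsmxMr; apply/sumsmx_subP=> z Dz; rewrite (eqmxMr _ (genmxE _)).
    apply: orbit_sum_incidence Dz => d Dd dw.
    have Dwd : d \in Dw by rewrite inE Dd.
    by rewrite -(rowB d Dwd) row_sub.
  apply/row_subP=> i; rewrite rowK submxMr // incidence_span //.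
  by have := repD i; rewrite inE => /andP[].
apply/eqP; rewrite -[_ == _]/(row_free B) -kermx_eq0.
apply/rowV0P=> c /sub_kermxP cB0; apply/rowP=> j; rewrite !mxE.
pose rep_i (i : 'I_#|orbs|) := repo (enum_val i).
(* the coefficient of incidence d once the orbit sums are expanded *)
pose a d := \sum_i \sum_(h in H | act (rep_i i) h == d) c 0 i.
have : a (repo (enum_val j)) = 0.
  apply: incidence_free (repD j); rewrite -[RHS]cB0 mulmx_sum_row.
  rewrite (eq_bigr (fun i => \sum_(h in H) \sum_(d in Dw | act (rep_i i) h == d)
      c 0 i *: incidence d)); last first.
    move=> i _; rewrite rowK mulmx_sumr scaler_sumr; apply: eq_bigr => h Hh.
    rewrite incidenceJ ?(subsetP sHG) //.
    rewrite (eq_bigl (pred1 (act (rep_i i) h))) ?big_pred1_eq //.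
    move=> d /=; rewrite eq_sym; case: eqP => [->|]; rewrite ?andbF ?andbT //.
    exact: act_Dw Hh (repD i).
  rewrite /a.
  have scaleE d :
      (\sum_i \sum_(h in H | act (rep_i i) h == d) c 0 i) *: incidence d =
      \sum_i \sum_(h in H | act (rep_i i) h == d) c 0 i *: incidence d.
    by rewrite scaler_suml; apply: eq_bigr => i _; rewrite scaler_suml.
  apply: etrans (eq_bigr _ (fun d _ => scaleE d)) _.
  rewrite exchange_big; apply: eq_bigr => i _.
  rewrite (exchange_big_dep (mem H)) /= => [|d h _ /andP[]//].
  by apply: eq_bigr => h Hh; apply: eq_bigl => d; rewrite Hh.
rewrite /a (bigD1 j) //= [X in _ + X]big1 ?addr0 => [/eqP | i ne_ij].
  rewrite sumr_const -mulr_natr mulf_eq0 Num.Theory.pnatr_eq0.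
  case/orP=> [/eqP // | /eqP/card0_eq/(_ 1%g)].
  by rewrite unfold_in /= group1 act1 eqxx.
rewrite big1 // => h /andP[Hh /eqP Eh]; case/eqP: ne_ij.
apply: enum_val_inj.
have /imsetP[d Dwd Ei] := enum_valP i; have /imsetP[d' Dwd' Ej] := enum_valP j.
have [g Hg Eg] := repoP Dwd; have [g' Hg' Eg'] := repoP Dwd'.
move: Eh; rewrite /rep_i Ei Ej Eg Eg' => Eh.
by rewrite -(orbit_act 'P^* d' Hg') -Eh !orbit_act.
Qed.

End Downset.
End Incidence.

(** * The layers of a space of functions *)

Lemma rank_rfix_rsim (gT : finGroupType) (G : {group gT})
    (U V : representation rat G) (H : {set gT}) :
  H \subset G -> mx_rsim U V -> \rank (rfix_mx U H) = \rank (rfix_mx V H).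
Proof.
move=> sHG simUV; suff le (W W' : representation rat G) : mx_rsim W W' ->
    (\rank (rfix_mx W H) <= \rank (rfix_mx W' H))%N.
  by apply/eqP; rewrite eqn_leq !le //; exact: mx_rsim_sym.
case=> B _ freeB homB; rewrite -(mxrankMfree _ freeB); apply: mxrankS.
apply/rfix_mxP=> h Hh; rewrite -mulmxA -homB ?(subsetP sHG) //.
by rewrite mulmxA rfix_mx_id.
Qed.

Section Layers.
Variables (F : finType) (G : {group {perm F}}) (X S : {set {set F}}).
Hypothesis nX : [acts G, on X | 'P^*].
Local Notation act d g := (('P^*)%act d g).
Local Notation rX := (permrep nX).
Variable y0 : {set F}.

(* as above; in addition every member of S contained in y0 is cut out on y0 by
   some y in X *)
Hypothesis capS : forall d d', d \in S -> d' \in S -> d :&: d' \in S.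
Hypothesis actS : forall d g, d \in S -> g \in G -> act d g \in S.
Hypothesis above_trans : forall d y y', d \in S -> y \in X -> y' \in X ->
  d \subset y -> d \subset y' -> exists2 g, g \in 'C_G(d | 'P) & act y g = y'.
Hypothesis glue : forall w z g, w \in S -> z \in S -> g \in 'C_G(w :&: z | 'P) ->
  w :&: act z g = w :&: z -> exists2 k, k \in 'C_G(w | 'P) & act z k = act z g.
Hypothesis sXS : X \subset S.
Hypothesis orbX : X = orbit 'P^* G y0.
Hypothesis above_y0 : forall d : {set F}, d \in S -> d \subset y0 ->
  exists2 y, y \in X & y0 :&: y = d.

Let Xy0 : y0 \in X. Proof. by rewrite orbX orbit_refl. Qed.
Let Sy0 : y0 \in S. Proof. exact: (subsetP sXS). Qed.

(* the existence of y passes from y0 to the submodules of y0 *)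
Let above_w (w : {set F}) : w \subset y0 ->
  forall d : {set F}, d \in S -> d \subset w ->
  exists2 y, y \in X & w :&: y = d.
Proof.
move=> wy0 d Sd dw; have [y Xy Ed] := above_y0 Sd (subset_trans dw wy0).
exists y => //; apply/setP=> a; rewrite -Ed !inE.
case wa: (a \in w); first by rewrite (subsetP wy0).
apply/esym/negbTE/negP=> /andP[ya y0a]; move: wa.
by rewrite (subsetP dw) // -Ed inE ya.
Qed.

Lemma card_setact (d : {set F}) (g : {perm F}) : #|act d g| = #|d|.
Proof. exact/card_imset/perm_inj. Qed.

Section Layer.
Variable x : {set F}.
Hypothesis (Sx : x \in S) (xy0 : x \subset y0).

(** The members of S of smaller size than x, then these together with the
    translates of x; both sets are closed under passage to submodules. *)
Definition smaller := [set d in S | (#|d| < #|x|)%N].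
Definition smaller_or_conj := smaller :|: orbit 'P^* G x.

Lemma smallerS : smaller \subset S.
Proof. by apply/subsetP=> d; rewrite inE => /andP[]. Qed.

Lemma smaller_act d g : d \in smaller -> g \in G -> act d g \in smaller.
Proof.
by rewrite !inE card_setact => /andP[Sd ->] Gg; rewrite actS.
Qed.

Lemma smaller_sub (d z : {set F}) :
  z \in smaller -> d \in S -> d \subset z -> d \in smaller.
Proof.
rewrite !inE => /andP[Sz ltz] -> dz /=.
exact: leq_ltn_trans (subset_leq_card dz) ltz.
Qed.

Lemma smaller_or_conjS : smaller_or_conj \subset S.
Proof.
by rewrite subUset smallerS; apply/subsetP=> _ /orbitP[g Gg <-]; apply: actS.
Qed.

Lemma smaller_or_conj_act d g :
  d \in smaller_or_conj -> g \in G -> act d g \in smaller_or_conj.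
Proof.
case/setUP=> [dx|/orbitP[h Gh <-]] Gg; first by rewrite in_setU smaller_act.
by rewrite -actM in_setU mem_orbit ?groupM ?orbT.
Qed.

Lemma card_conj (d : {set F}) : d \in orbit 'P^* G x -> #|d| = #|x|.
Proof. by case/orbitP=> g _ <-; rewrite card_setact. Qed.

Lemma smaller_or_conj_sub (d z : {set F}) :
  z \in smaller_or_conj -> d \in S -> d \subset z -> d \in smaller_or_conj.
Proof.
case/setUP=> zx Sd dz.
  by rewrite in_setU (smaller_sub zx Sd dz).
have [-> | ne_dz] := eqVneq d z; first by rewrite in_setU zx orbT.
rewrite !inE Sd -(card_conj zx) proper_card //.
by rewrite properEneq ne_dz.
Qed.

Local Notation span := (span_incidence nX).
Local Notation stab w := ('C_G[w | 'P^*]%G).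
Local Notation sum w := (orbit_sum (stab w) rX).

(** The orbits of the stabilizer of w on the translates of x contained in w. *)
Definition orbits_below (w : {set F}) :=
  orbit 'P^* (stab w) @: [set d in orbit 'P^* G x | d \subset w].

(** The layer U of x is a complement, unique up to isomorphism.  Directness is
    stated as a trivial intersection because mxdirect would look inside the sum
    defining span_incidence. *)
Lemma layer_exists : exists U : 'M_(rdegree rX),
  [/\ mxmodule rX U, (span smaller + U :=: span smaller_or_conj)%MS &
      (span smaller :&: U = 0)%MS].
Proof.
have modL := span_incidence_module nX smaller_or_conj_act.
have modl := span_incidence_module nX smaller_act.
have sub : (span smaller <= span smaller_or_conj)%MS.
  apply: span_incidence_sub => d dx.
  by apply: incidence_span; rewrite in_setU dx.
have [U modU defU dxU] := mx_reducibleS modL (submx1 _)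
  (mx_Maschke_pchar rX (rat_pchar' G)) modl sub.
exists U; split=> //; exact: mxdirect_addsP dxU.
Qed.

Variable U : 'M[rat]_(rdegree rX).
Hypothesis modU : mxmodule rX U.
Hypothesis defU : (span smaller + U :=: span smaller_or_conj)%MS.
Hypothesis dxU : (span smaller :&: U = 0)%MS.

(** The dimension of the space of vectors of U fixed by the stabilizer of w. *)
Lemma rank_layer_sum (w : {set F}) : w \in S -> w \subset y0 ->
  \rank (U *m sum w) = #|orbits_below w|.
Proof.
move=> Sw wy0.
have modl := span_incidence_module nX smaller_act.
have := rank_orbit_sum_direct (subsetIl _ _ : stab w \subset G) modl modU defU dxU.
rewrite (rank_orbit_sum_span nX capS above_trans glue smallerS smaller_act
  smaller_sub Sw (above_w wy0)).
rewrite (rank_orbit_sum_span nX capS above_trans glue smaller_or_conjS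
  smaller_or_conj_act smaller_or_conj_sub Sw (above_w wy0)).
have -> : [set d in smaller_or_conj | d \subset w] =
    [set d in smaller | d \subset w] :|: [set d in orbit 'P^* G x | d \subset w].
  by apply/setP=> d; rewrite !inE andb_orl.
rewrite imsetU cardsU [X in (_ - X)%N](_ : _ = 0%N) ?subn0 => [/addnI<-//|].
apply/eqP; rewrite cards_eq0 -subset0; apply/subsetP=> o /setIP[].
case/imsetP=> d; rewrite !inE => /andP[/andP[_ lt_d] _] ->.
case/imsetP=> d'; rewrite inE => /andP[/card_conj Ed' _] Eo.
have : d \in orbit 'P^* (stab w) d' by rewrite -Eo orbit_refl.
case/orbitP=> h _ Ed; move: lt_d.
by rewrite -Ed card_setact Ed' ltnn.
Qed.

(** If g moves x to a submodule d of y0, then d is contained both in y0 and in its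
    image by g, and an element fixing d pointwise moves this image to y0. *)
Lemma orbits_below_y0 : #|orbits_below y0| = 1%N.
Proof.
apply/eqP/cards1P; exists (orbit 'P^* (stab y0) x); apply/setP=> o; rewrite inE.
apply/imsetP/eqP=> [[d] | ->]; last first.
  by exists x => //; rewrite inE orbit_refl.
rewrite inE => /andP[/orbitP[g Gg Ed] dy0] ->; apply/orbit_eqP.
have Xg : act y0 g \in X by rewrite (acts_act nX).
have Sd : d \in S by rewrite -Ed actS.
have dg : d \subset act y0 g by rewrite -Ed subset_setact.
have [k /setIP[Gk Ck] Ey] := above_trans Sd Xg Xy0 dg dy0.
apply/orbitP; exists (g * k)%g; last by rewrite actM Ed sub_astab_act.
rewrite inE groupM //; apply/astab1P.
by rewrite actM.
Qed.

(** By translation there is a function in A that does not vanish at y0, and the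
    sum over the stabilizer multiplies its value at y0 by the order of the
    stabilizer. *)
Lemma submodule_sum_neq0 (A : 'M_(rdegree rX)) :
  mxmodule rX A -> A != 0 -> A *m sum y0 != 0.
Proof.
move=> modA /rowV0Pn[v sv nz_v].
have /existsP[i nz_i] : [exists i, v 0 i != 0].
  apply: contraR nz_v; rewrite negb_exists => /forallP v0.
  by apply/eqP/rowP=> i; rewrite mxE; apply/eqP/negbNE.
have := enum_valP i; rewrite {2}orbX => /orbitP[g Gg Eg].
have Gg' := groupVr Gg; set u : 'rV_#|X| := v *m rX g^-1%g.
pose i0 := enum_rank_in Xy0 y0.
have su : (u <= A)%MS by apply: submx_trans (mxmoduleP modA _ Gg'); rewrite submxMr.
have valJ (z : 'rV_#|X|) h y (Xy : y \in X) : h \in G ->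
    (z *m permrep_mx 'P^* X h) 0 (enum_rank_in Xy0 (act y h))
      = z 0 (enum_rank_in Xy0 y).
  move=> Gh; pose f (y : {set F}) := z 0 (enum_rank_in Xy0 y).
  have -> : z = \row_i f (enum_val i).
    by apply/rowP=> j; rewrite mxE /f enum_valK_in.
  by rewrite (permrepE nX) // !mxE !enum_rankK_in ?(acts_act nX) // actK.
have u0 : u 0 i0 != 0.
  rewrite /i0 -{2}(actK 'P^* g y0) Eg valJ ?enum_valP //.
  by rewrite enum_valK_in.
suff nz : u *m sum y0 != 0.
  apply: contraNneq nz => A0; rewrite -submx0 -A0; exact: submxMr.
apply/eqP=> /rowP/(_ i0); rewrite mulmx_sumr summxE mxE.
rewrite (eq_bigr (fun=> u 0 i0)) => [|h /setIP[Gh /astab1P Eh]]; last first.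
  by rewrite /i0 -[RHS](valJ u h y0 Xy0 Gh) Eh.
rewrite sumr_const -mulr_natr => /eqP; rewrite mulf_eq0 (negbTE u0) /=.
by rewrite Num.Theory.pnatr_eq0 -leqn0 leqNgt cardG_gt0.
Qed.

(** A proper decomposition of U would give at least two independent vectors fixed
    by the stabilizer of y0. *)
Lemma layer_simple : mxsimple rX U.
Proof.
have rkU : \rank (U *m sum y0) = 1%N by rewrite rank_layer_sum ?orbits_below_y0.
split=> // [|V modV sVU nzV].
  by apply: contra_eq_neq rkU => ->; rewrite mul0mx mxrank0.
have [W modW defW dxW] := mx_reducibleS modU (submx1 _)
  (mx_Maschke_pchar rX (rat_pchar' G)) modV sVU.
have := rank_orbit_sum_direct (subsetIl _ _ : stab y0 \subset G) modV modW defW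
  (mxdirect_addsP dxW).
rewrite rkU => rk; suff W0 : W = 0 by rewrite -defW W0 addsmx0.
apply: contraTeq isT => nzW.
have := submodule_sum_neq0 modV nzV; have := submodule_sum_neq0 modW nzW.
rewrite -!mxrank_eq0; move: rk.
by case: (\rank _) => // a; case: (\rank _) => // b; rewrite addnS.
Qed.

Lemma rank_rfix_layer (w : {set F}) : w \in S -> w \subset y0 ->
  \rank (rfix_mx (submod_repr modU) 'C_G[w | 'P^*]) = #|orbits_below w|.
Proof.
move=> Sw wy0; rewrite -rank_layer_sum //.
exact: (rank_rfix_submod (subsetIl _ _ : stab w \subset G)).
Qed.

Lemma layer_hom_dim : hom_dim (Representation (submod_repr modU))
                              (Representation (submod_repr modU)) 1.
Proof.
apply: (@hom_dim_self _ G _ 'C_G[y0 | 'P^*]).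
- exact/submod_mx_irr/layer_simple.
- exact: subsetIl.
by rewrite /= rank_rfix_layer // orbits_below_y0.
Qed.

End Layer.

Lemma orbits_below_self x : #|orbits_below x x| = 1%N.
Proof.
apply/eqP/cards1P; exists (orbit 'P^* 'C_G[x | 'P^*] x).
rewrite /orbits_below; suff -> : [set d in orbit 'P^* G x | d \subset x] = [set x].
  by rewrite imset_set1.
apply/setP=> d; rewrite !inE; apply/andP/eqP=> [[dx sdx] | ->].
  by apply/eqP; rewrite eqEcard sdx (card_conj dx) leqnn.
by rewrite orbit_refl subxx.
Qed.

Lemma orbits_below_neq0 x w : orbits_below x w != set0 ->
  exists2 d, d \in orbit 'P^* G x & d \subset w.
Proof.
by case/set0Pn=> o /imsetP[d]; rewrite inE => /andP[dx dw] _; exists d.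
Qed.

Section Decomposition.
Variables (I : finType) (x : I -> {set F}).
Hypothesis x_S : forall i, x i \in S.
Hypothesis x_y0 : forall i, x i \subset y0.
Hypothesis x_inj : forall i j, x i \in orbit 'P^* G (x j) -> i = j.
Hypothesis x_cover : forall d, d \in S -> d \subset y0 ->
  exists i, d \in orbit 'P^* G (x i).

(** For representatives x_i of the orbits of members of S contained in y0, the
    layers are irreducible and pairwise non-isomorphic, and their sum is the
    permutation representation on X. *)
Theorem layers_exist : exists U : I -> representation rat G,
  [/\ forall i, mx_irreducible (U i), forall i, hom_dim (U i) (U i) 1,
      forall i (w : {set F}), w \in S -> w \subset y0 ->
        \rank (rfix_mx (U i) 'C_G[w | 'P^*]) = #|orbits_below (x i) w|,
      forall i j, mx_rsim (U i) (U j) -> i = j &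
      mx_rsim rX (\big[@dadd_grepr _ _ _/grepr0]_(i : I) U i)].
Proof.
have /choice[A AP] := fun i => layer_exists (x i).
have modA i : mxmodule rX (A i) by have [] := AP i.
pose U i := Representation (submod_repr (modA i)).
have simA i : mxsimple rX (A i).
  have [_ defA dxA] := AP i.
  exact (layer_simple (x_S i) (x_y0 i) (modA i) defA dxA).
have rkU i (w : {set F}) : w \in S -> w \subset y0 ->
    \rank (rfix_mx (U i) 'C_G[w | 'P^*]) = #|orbits_below (x i) w|.
  by have [_ defA dxA] := AP i; apply: (rank_rfix_layer (x_S i)).
have below i j : mx_rsim (U i) (U j) ->
    exists2 d, d \in orbit 'P^* G (x j) & d \subset x i.
  move=> simU; apply: orbits_below_neq0; rewrite -card_gt0 -rkU //.
  rewrite -(rank_rfix_rsim _ simU) ?subsetIl // rkU //.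
  by rewrite orbits_below_self.
have injU i j : mx_rsim (U i) (U j) -> i = j.
  move=> simU; have [d dxj dxi] := below i j simU.
  have [d' d'xi d'xj] := below j i (mx_rsim_sym simU).
  apply: x_inj; suff <- : d = x i by [].
  apply/eqP; rewrite eqEcard dxi (card_conj dxj) -(card_conj d'xi).
  exact: subset_leq_card.
exists U; split=> //.
- by move=> i; apply/submod_mx_irr.
- move=> i; have [_ defA dxA] := AP i.
  exact (layer_hom_dim (x_S i) (x_y0 i) (modA i) defA dxA).
(* every incidence vector lies in the sum, by induction on the size of d; at d in
   X it is a point mass *)
have full : (\sum_i A i :=: 1%:M)%MS.
  apply/eqmxP; rewrite submx1 /=.
  have all d : d \in S -> (incidence nX d <= \sum_i A i)%MS.
    have [j] := ubnP #|d|; elim: j d => // j IHj d /ltnSE lej Sd.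
    have [/existsP[y /andP[Xy dy]] | no_y] :=
        boolP [exists y, (y \in X) && (d \subset y)]; last first.
      rewrite incidence0 ?sub0mx // => y Xy; apply: contra no_y => dy.
      by apply/existsP; exists y; rewrite Xy.
    have [g Gg Ey] : exists2 g, g \in G & act y g = y0.
      move: Xy; rewrite orbX => /orbitP[g Gg Ey].
      by exists g^-1%g; rewrite ?groupV // -Ey actK.
    have [i dxi] : exists i, d \in orbit 'P^* G (x i).
      have dgy0 : act d g \subset y0 by rewrite -Ey subset_setact.
      have [|i /orbitP[h Gh Eh]] := x_cover _ dgy0; first exact: actS.
      exists i; apply/orbitP; exists (h * g^-1)%g; rewrite ?groupM ?groupV //.
      by rewrite actM Eh actK.
    have [_ defA _] := AP i.
    have : (incidence nX d <= span_incidence nX (smaller_or_conj (x i)))%MS.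
      by apply: incidence_span; rewrite in_setU dxi orbT.
    rewrite -defA => /submx_trans; apply; rewrite addsmx_sub.
    apply/andP; split; last exact: (sumsmx_sup i).
    apply: span_incidence_sub => z.
    rewrite inE => /andP[Sz lt_z]; apply: IHj => //.
    by apply: leq_trans lej; rewrite (card_conj dxi).
  apply/row_subP=> i; rewrite row1; have Xi := enum_valP i.
  suff -> : delta_mx 0 i = incidence nX (enum_val (i : 'I_#|X|)).
    by apply: all; apply: (subsetP sXS).
  apply/rowP=> j; rewrite !mxE eqxx /=; congr (_ %:R); congr nat_of_bool.
  rewrite -(inj_eq enum_val_inj) eq_sym eqEcard.
  have cX y : y \in X -> #|y| = #|y0| by rewrite orbX => /card_conj.
  by rewrite !cX ?enum_valP // leqnn andbT.
(* a sum of pairwise non-isomorphic simple modules is direct *)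
have dx : mxdirect (\sum_i A i).
  apply/mxdirect_sumsP=> i _; apply/eqP/idPn=> nz.
  have [modi nzi simi] := simA i.
  have modW : mxmodule rX (\sum_(j | j != i) A j)%MS by apply: sumsmx_module.
  have sub : (A i <= \sum_(j | j != i) A j)%MS.
    apply: submx_trans (capmxSr (A i) _).
    by apply: simi nz; rewrite ?capmxSl //; apply: capmx_module.
  have [|j ne_ji /mx_rsim_iso] :=
    hom_mxsemisimple_iso (simA i) (fun j _ _ => simA j)
    (scalar_mx_hom rX 1 (\sum_(j | j != i) A j)%MS); first by rewrite mulmx1.
  by move=> /(_ (modA j) (modA i)) /injU E; rewrite E eqxx in ne_ji.
apply: mx_rsim_trans (mx_rsim_sym (rsim_submod1 (mxmodule1 rX) _)) _ => //.
exact (@mx_rsim_dsum _ _ _ _ rX I xpredT A U 1%:M modA (mxmodule1 rX) full dx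
         (fun i => mx_rsim_refl (U i))).
Qed.

End Decomposition.
End Layers.

(** * Extension of linear maps between finite modules *)

Section LinearRelations.
Variable O : idomainType.

(** A functional linear relation is contained in the graph of a function, which
    is linear on the domain of the relation; elsewhere its values are arbitrary. *)
Lemma linear_relation_fun (M N : lmodType O) (Rel : M -> N -> Prop) :
    (forall a x x' y y', Rel x y -> Rel x' y' -> Rel (a *: x + x') (a *: y + y')) ->
    (forall y, Rel 0 y -> y = 0) ->
  exists h : M -> N, forall x y, Rel x y -> h x = y.
Proof.
move=> linRel Rel0.
have funRel x y y' : Rel x y -> Rel x y' -> y = y'.
  move=> Rxy Rxy'; have := linRel (-1) _ _ _ _ Rxy Rxy'.
  rewrite !scaleN1r addNr => /Rel0 /eqP.
  by rewrite addrC subr_eq0 => /eqP.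
have /choice[h hP] x : exists y, (exists y', Rel x y') -> Rel x y.
  case: (pselect (exists y', Rel x y')) => [[y Rxy]|no]; last by exists 0 => /no[].
  by exists y.
exists h => x y Rxy; apply/esym/(funRel _ _ _ Rxy)/hP; by exists y.
Qed.

Section FiniteModule.
Variable F : finLmodType O.
Implicit Types (A B M N Y : {set F}) (f : F -> F).

(** A is an O-submodule of F. *)
Definition is_submod A :=
  0 \in A /\ forall a x y, x \in A -> y \in A -> a *: x + y \in A.

(** f is linear on the submodule A. *)
Definition lin_on A f := forall a x y, x \in A -> y \in A ->
  f (a *: x + y) = a *: f x + f y.

Lemma submodD A x y : is_submod A -> x \in A -> y \in A -> x + y \in A.
Proof. by case=> _ linA Ax Ay; rewrite -[x]scale1r linA. Qed.

Lemma submodZ A a x : is_submod A -> x \in A -> a *: x \in A.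
Proof. by case=> A0 linA Ax; rewrite -[_ *: x]addr0 linA. Qed.

Lemma submodB A x y : is_submod A -> x \in A -> y \in A -> x - y \in A.
Proof. by move=> sA Ax Ay; rewrite -scaleN1r addrC; apply: sA.2. Qed.

Lemma submod_set0 : is_submod [set 0].
Proof.
by split=> [|a x y]; rewrite !inE // => /eqP-> /eqP->; rewrite scaler0 addr0.
Qed.

Lemma submodT : is_submod setT.
Proof. by split=> *; rewrite inE. Qed.

Lemma submodI A B : is_submod A -> is_submod B -> is_submod (A :&: B).
Proof.
move=> sA sB; split=> [|a x y]; rewrite !inE ?sA.1 ?sB.1 //.
by case/andP=> Ax Bx /andP[Ay By]; rewrite sA.2 // sB.2.
Qed.

Lemma lin_on0 A f : is_submod A -> lin_on A f -> f 0 = 0.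
Proof.
move=> sA linf; have := linf (-1) 0 0 sA.1 sA.1.
by rewrite !scaleN1r !addNr.
Qed.

Lemma lin_onZ A f a x : is_submod A -> lin_on A f -> x \in A ->
  f (a *: x) = a *: f x.
Proof.
move=> sA linf Ax; have := linf a x 0 Ax sA.1.
by rewrite !addr0 (lin_on0 sA linf) addr0.
Qed.

Lemma lin_onB A f x y : is_submod A -> lin_on A f -> x \in A -> y \in A ->
  f (x - y) = f x - f y.
Proof.
move=> sA linf Ax Ay; have := linf (-1) y x Ay Ax.
by rewrite !scaleN1r ![- _ + _]addrC.
Qed.

Lemma lin_onD A f x y : is_submod A -> lin_on A f -> x \in A -> y \in A ->
  f (x + y) = f x + f y.
Proof. by move=> sA linf Ax Ay; have := linf 1 x y Ax Ay; rewrite !scale1r. Qed.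

Lemma lin_on_inj A f : is_submod A -> lin_on A f ->
  (forall x, x \in A -> f x = 0 -> x = 0) -> {in A &, injective f}.
Proof.
move=> sA linf inj0 x y Ax Ay E; apply/eqP; rewrite -subr_eq0; apply/eqP.
by apply: inj0; rewrite ?submodB // (lin_onB sA) // E subrr.
Qed.

Lemma submod_imset A f : is_submod A -> lin_on A f -> is_submod (f @: A).
Proof.
move=> sA linf; split=> [|a _ _ /imsetP[x Ax ->] /imsetP[y Ay ->]].
  by apply/imsetP; exists 0; rewrite ?sA.1 // (lin_on0 sA).
by rewrite -linf // imset_f // sA.2.
Qed.

(** The cardinal of the image times that of the kernel. *)
Lemma card_lin_on B N f : is_submod B -> lin_on B f -> N \subset B ->
  (forall x, x \in B -> (f x == 0) = (x \in N)) -> (#|f @: B| * #|N| = #|B|)%N.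
Proof.
move=> sB linf sNB kerf.
rewrite -[RHS]sum1_card (partition_big_imset f) /= -sum_nat_const.
apply: eq_bigr => _ /imsetP[x0 Bx0 ->].
rewrite sum1dep_card -(card_imset _ (addrI x0)); apply: eq_card => y.
rewrite !inE; apply/imsetP/andP=> [[z Nz ->] | [By /eqP Ey]].
  have Bz := subsetP sNB z Nz; rewrite submodD // (lin_onD sB) //.
  by move: Nz; rewrite -kerf // => /eqP->; rewrite addr0.
exists (y - x0); last by rewrite addrC subrK.
by rewrite -kerf ?submodB // (lin_onB sB) // Ey subrr.
Qed.

Section Uniformizer.
Variables (pi : O) (k : nat).
Hypothesis k_gt0 : (0 < k)%N.
Hypothesis local_pi : forall a, (exists b, a = pi * b) \/
  exists b c, a * b = 1 - pi ^+ k * c.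
Hypothesis piF : forall x : F, pi ^+ k *: x = 0.

(** In its action on F, a scalar is divisible by pi or invertible. *)
Lemma unit_or_pi a :
  (exists b, a = pi * b) \/ exists b, forall x : F, b *: (a *: x) = x.
Proof.
case: (local_pi a) => [|[b [c E]]]; [by left | right; exists b => x].
rewrite scalerA mulrC E scalerBl scale1r mulrC -scalerA piF scaler0.
exact: subr0.
Qed.

(** The elements of A annihilated by pi. *)
Definition socle A := [set x in A | pi *: x == 0].

(** An element of Y that pi ^+ k.-1 annihilates is divisible by pi in Y.  For
    modules annihilated by pi ^+ k this amounts to injectivity. *)
Definition divisible Y := forall x, x \in Y -> pi ^+ k.-1 *: x = 0 ->
  exists2 u, u \in Y & x = pi *: u.

Lemma nonmember_pi A v r : is_submod A -> v \notin A -> r *: v \in A ->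
  exists s, r = pi * s.
Proof.
move=> sA nAv Arv; case: (unit_or_pi r) => // [[b Eb]].
by case/negP: nAv; rewrite -[v]Eb submodZ.
Qed.

(** The submodule generated by A and v. *)
Definition adjoin A v := [set x | `[< exists r a, a \in A /\ x = r *: v + a >]].

Lemma adjoinP A v x :
  reflect (exists r a, a \in A /\ x = r *: v + a) (x \in adjoin A v).
Proof. by rewrite inE; apply: asboolP. Qed.

Lemma adjoin_submod A v : is_submod A -> is_submod (adjoin A v).
Proof.
move=> sA; split=> [|a x y].
  by apply/adjoinP; exists 0, 0; rewrite sA.1 scale0r addr0.
move=> /adjoinP[r [x' [Ax' ->]]] /adjoinP[s [y' [Ay' ->]]].
apply/adjoinP; exists (a * r + s), (a *: x' + y'); rewrite sA.2 //; split=> //.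
by rewrite scalerDr scalerDl scalerA addrACA.
Qed.

Lemma sub_adjoin A v : A \subset adjoin A v.
Proof.
by apply/subsetP=> a Aa; apply/adjoinP; exists 0, a; rewrite scale0r add0r.
Qed.

Lemma mem_adjoin A v : is_submod A -> v \in adjoin A v.
Proof.
by move=> sA; apply/adjoinP; exists 1, 0; rewrite scale1r addr0 sA.1.
Qed.

(** A map with kernel N extends to A + O v with the same kernel when pi v lies in
    A and the value u chosen at v is compatible and outside the image of A. *)
Lemma extend_step Y N A f v u :
    is_submod Y -> is_submod A -> lin_on A f ->
    (forall a, a \in A -> f a \in Y) -> N \subset A ->
    (forall a, a \in A -> (f a == 0) = (a \in N)) ->
    v \notin A -> pi *: v \in A -> u \in Y -> pi *: u = f (pi *: v) ->
    u \notin f @: A ->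
  exists f', [/\ lin_on (adjoin A v) f', {in A, f' =1 f},
    forall a, a \in adjoin A v -> f' a \in Y &
    forall a, a \in adjoin A v -> (f' a == 0) = (a \in N)].
Proof.
move=> sY sA linf fY sNA kerf nAv Apv Yu Eu nfu.
have fA r : r *: v \in A -> f (r *: v) = r *: u.
  move=> Arv; have [s ->] := nonmember_pi sA nAv Arv.
  by rewrite mulrC -!scalerA Eu (lin_onZ _ sA).
have [|y|h hP] := @linear_relation_fun F F
    (fun x y => exists r a, [/\ a \in A, x = r *: v + a & y = r *: u + f a]).
- move=> a x x' y y' [r [b [Ab -> ->]]] [r' [b' [Ab' -> ->]]].
  exists (a * r + r'), (a *: b + b'); rewrite sA.2 // linf //; split=> //.
    by rewrite scalerDr scalerDl scalerA addrACA.
  by rewrite scalerDr scalerDl scalerA addrACA.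
- case=> r [a [Aa /esym/eqP E ->]]; move: E; rewrite addrC addr_eq0 => /eqP E.
  have Arv : r *: v \in A by rewrite -[_ *: v]opprK -E -scaleN1r submodZ.
  rewrite -fA // E -[- _]scaleN1r (lin_onZ (-1) sA linf) // scaleN1r.
  exact: subrr.
have hE r a : a \in A -> h (r *: v + a) = r *: u + f a.
  by move=> Aa; apply: hP; exists r, a.
have hA : {in A, h =1 f}.
  by move=> a Aa; have := hE 0 a Aa; rewrite !scale0r !add0r.
exists h; split=> //.
- move=> a x y /adjoinP[r [b [Ab ->]]] /adjoinP[r' [b' [Ab' ->]]].
  rewrite !hE // scalerDr addrACA scalerA -scalerDl hE ?sA.2 // linf //.
  by rewrite scalerDr scalerDl scalerA addrACA.
- move=> _ /adjoinP[r [b [Ab ->]]]; rewrite hE //.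
  by apply: sY.2 => //; apply: fY.
move=> x A'x; case Ax: (x \in A); first by rewrite hA // kerf.
have -> : x \in N = false by apply: contraFF Ax => /(subsetP sNA).
apply: contraFF Ax => /eqP; case/adjoinP: A'x => r [b [Ab ->]]; rewrite hE // => E.
(* if r were invertible then u would lie in the image of A *)
case: (unit_or_pi r) => [[s Er] | [c Ec]].
  by rewrite Er mulrC -scalerA sA.2.
case/negP: nfu; apply/imsetP; exists (- c *: b); first exact: submodZ.
rewrite (lin_onZ _ sA linf) // scaleNr -[LHS]Ec -scalerN; congr (_ *: _).
by apply/eqP; rewrite -addr_eq0 E.
Qed.

(** A linear map from A to Y with kernel N extends to M with the same kernel, when
    the elements that pi sends into N are not too many. *)
Lemma extend_into_divisible M Y N A f :
    is_submod M -> is_submod Y -> is_submod N -> is_submod A ->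
    divisible Y -> A \subset M -> N \subset A ->
    lin_on A f -> (forall a, a \in A -> f a \in Y) ->
    (forall a, a \in A -> (f a == 0) = (a \in N)) ->
    (#|[set v in M | pi *: v \in N]| <= #|N| * #|socle Y|)%N ->
  exists f', [/\ lin_on M f', {in A, f' =1 f},
    forall a, a \in M -> f' a \in Y &
    forall a, a \in M -> (f' a == 0) = (a \in N)].
Proof.
move=> sM sY sN sA divY; have [j] := ubnP (#|M| - #|A|)%N.
elim: j A f sA => // j IHj A f sA /ltnSE lej sAM sNA linf fY kerf leS.
set S := [set v in M | _] in leS.
have [E | neAM] := eqVneq A M; first by subst A; exists f; split.
suff [v [u [Mv nAv Apv Yu [Eu nfu]]]] : exists v u, [/\ v \in M, v \notin A,
    pi *: v \in A, u \in Y & pi *: u = f (pi *: v) /\ u \notin f @: A].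
  have [h [linh hA hY kerh]] :=
    extend_step sY sA linf fY sNA kerf nAv Apv Yu Eu nfu.
  have sA'M : adjoin A v \subset M.
    apply/subsetP=> x /adjoinP[r [a [Aa ->]]].
    by apply: sM.2 => //; apply: (subsetP sAM).
  have ltA : (#|A| < #|adjoin A v|)%N.
    apply: proper_card; apply/properP; split; first exact: sub_adjoin.
    by exists v => //; apply: mem_adjoin.
  have [||h' [linh' h'A h'Y kerh']] :=
      IHj _ h (adjoin_submod v sA) _ sA'M _ linh hY kerh leS.
  - apply: leq_trans lej; apply: ltn_sub2l => //.
    exact: leq_trans ltA (subset_leq_card sA'M).
  - exact: subset_trans sNA (sub_adjoin A v).
  exists h'; split=> // a Aa; rewrite h'A ?hA //.
  exact: (subsetP (sub_adjoin A v)).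
(* if some v with pi v in N is missing from A, then counting gives an element u
   of the socle of Y outside the image of A *)
have [sSA | /subsetPn[v Sv nAv]] := boolP (S \subset A); last first.
  move: Sv; rewrite inE => /andP[Mv Npv].
  have Apv := subsetP sNA _ Npv.
  suff /subsetPn[u] : ~~ (socle Y \subset f @: A).
    rewrite inE => /andP[Yu /eqP Eu] nfu; exists v, u; split=> //; split=> //.
    by rewrite Eu; apply/esym/eqP; rewrite kerf.
  apply/negP=> sub; have : (#|socle Y| * #|N| <= #|A :&: S|)%N.
    have sS : is_submod S.
      split=> [|a x y]; rewrite !inE; first by rewrite sM.1 scaler0 sN.1.
      move=> /andP[Mx Nx] /andP[My Ny]; rewrite sM.2 //= scalerDr scalerA.
      by rewrite mulrC -scalerA sN.2.
    have sAS := submodI sA sS.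
    have sNAS : N \subset A :&: S.
      apply/subsetP=> x Nx; have Ax := subsetP sNA x Nx.
      by rewrite !inE Ax (subsetP sAM) //= submodZ.
    have linS : lin_on (A :&: S) f.
      by move=> a x y /setIP[Ax _] /setIP[Ay _]; apply: linf.
    rewrite -(card_lin_on sAS linS sNAS) => [|x /setIP[Ax _]]; last exact: kerf.
    rewrite leq_mul2r; apply/orP; right; apply: subset_leq_card.
    apply/subsetP=> u socu; have /imsetP[a Aa Ea] := subsetP sub u socu.
    move: socu; rewrite Ea inE => /andP[_ pu]; apply: imset_f; rewrite !inE Aa.
    by rewrite (subsetP sAM) //= -kerf ?submodZ // (lin_onZ _ sA linf).
  rewrite leqNgt mulnC => /negP; apply; apply: leq_trans leS.
  apply: proper_card; rewrite properE subsetIr /=; apply/subsetPn; exists v.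
    by rewrite inE Mv.
  by rewrite inE (negbTE nAv).
(* otherwise a multiple v of any v0 outside A has pi v in A, and any u with
   pi u = f (pi v) is outside the image of A *)
have [v0 Mv0 nAv0] : exists2 v, v \in M & v \notin A.
  by apply/subsetPn; apply: contra neAM => sMA; rewrite eqEsubset sAM.
have ex_pow : exists j, pi ^+ j *: v0 \in A by exists k; rewrite piF sA.1.
case: (ex_minnP ex_pow) => [[|i]]; first by rewrite expr0 scale1r (negbTE nAv0).
move=> Api min_i; pose v := pi ^+ i *: v0.
have Epv : pi *: v = pi ^+ i.+1 *: v0 by rewrite scalerA -exprS.
have Apv : pi *: v \in A by rewrite Epv.
have nAv : v \notin A by apply: contraFN (ltnn i) => /min_i.
have Mv : v \in M by apply: submodZ.
have [|u Yu Eu] := divY _ (fY _ Apv).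
  rewrite -(lin_onZ _ sA linf) // scalerA -exprSr prednK // piF.
  exact: lin_on0 sA linf.
exists v, u; split=> //; split=> //.
apply/imsetP=> [[b Ab Eb]]; case/negP: nAv.
rewrite -[v](subrK b); apply: submodD => //; apply: (subsetP sSA).
have Mvb : v - b \in M by apply: submodB => //; apply: (subsetP sAM).
rewrite inE Mvb /= -kerf; last by rewrite scalerBr submodB // submodZ.
have Apb : pi *: b \in A by apply: submodZ.
by rewrite scalerBr (lin_onB sA linf) // (lin_onZ pi sA linf Ab) -Eb Eu subrr.
Qed.

Lemma card_pi_preim M N : is_submod M -> is_submod N ->
  (#|[set v in M | pi *: v \in N]| <= #|N| * #|socle M|)%N.
Proof.
move=> sM sN; set S := [set v in M | _].
have sS : is_submod S.
  split=> [|a x y]; rewrite !inE; first by rewrite sM.1 scaler0 sN.1.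
  move=> /andP[Mx Nx] /andP[My Ny]; rewrite sM.2 //= scalerDr scalerA.
  by rewrite mulrC -scalerA sN.2.
have linpi : lin_on S (fun v => pi *: v).
  by move=> a x y _ _; rewrite scalerDr !scalerA mulrC.
rewrite -(card_lin_on (N := socle M) sS linpi).
- rewrite leq_mul2r; apply/orP; right; apply: subset_leq_card.
  by apply/subsetP=> _ /imsetP[v + ->]; rewrite inE => /andP[].
- by apply/subsetP=> x; rewrite !inE => /andP[-> /eqP->]; rewrite sN.1.
by move=> x; rewrite !inE => /andP[-> _].
Qed.

(** When F is divisible, an isomorphism between submodules of F extends to an
    automorphism of F. *)
Lemma extend_to_perm A f : divisible setT -> is_submod A -> lin_on A f ->
    {in A &, injective f} ->
  exists2 g : {perm F}, {in A, g =1 f} &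
    forall a x y, g (a *: x + y) = a *: g x + g y.
Proof.
move=> divF sA linf injf.
have kerf a : a \in A -> (f a == 0) = (a \in [set 0]).
  move=> Aa; rewrite inE -{1}(lin_on0 sA linf); apply/eqP/eqP=> [|-> //].
  by apply: injf => //; apply: sA.1.
have sN0 : [set 0] \subset A.
  by apply/subsetP=> x; rewrite inE => /eqP->; apply: sA.1.
have [h [linh hA _ kerh]] :=
  extend_into_divisible submodT submodT submod_set0 sA divF (subsetT A) sN0 linf
    (fun a _ => in_setT (f a)) kerf (card_pi_preim submodT submod_set0).
have injh : injective h.
  move=> x y; apply: (lin_on_inj submodT linh); rewrite ?inE // => z _ /eqP.
  by rewrite kerh ?inE // => /eqP.
exists (perm injh) => [x Ax|a x y]; first by rewrite permE hA.
by rewrite !permE linh ?inE.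
Qed.

(** The case N = 0 and f = id: y embeds in y' by a map fixing d. *)
Lemma iso_above d y y' : is_submod d -> is_submod y -> is_submod y' ->
    divisible y' -> #|socle y| = #|socle y'| -> d \subset y -> d \subset y' ->
  exists f, [/\ lin_on y f, {in y &, injective f}, {in d, f =1 id} &
                forall a, a \in y -> f a \in y'].
Proof.
move=> sd sy sy' div soc_eq dy dy'.
have s0d : [set 0] \subset d.
  by apply/subsetP=> x; rewrite inE => /eqP->; apply: sd.1.
have lin_id : lin_on d id by [].
have id_y' a : a \in d -> id a \in y' by move/(subsetP dy').
have ker_id a : a \in d -> (id a == 0) = (a \in [set 0]) by rewrite inE.
have := card_pi_preim sy submod_set0; rewrite soc_eq.
case/(extend_into_divisible sy sy' submod_set0 sd div dy s0d lin_id id_y' ker_id).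
move=> f [linf fd fy kerf].
exists f; split=> //; apply: (lin_on_inj sy linf) => x yx /eqP.
by rewrite kerf // inE => /eqP.
Qed.

(** The zero map on d extends to a map h from y to c with kernel d; the image of
    y under f = id + h meets y in d, because c meets y in 0. *)
Lemma cap_above d y c : is_submod d -> is_submod y -> is_submod c ->
    divisible c -> #|socle y| = #|socle c| -> d \subset y ->
    (forall x, x \in y -> x \in c -> x = 0) ->
  exists f, [/\ lin_on y f, {in y &, injective f} & y :&: f @: y = d].
Proof.
move=> sd sy sc div soc_eq dy yc0.
have lin0 : lin_on d (fun=> 0) by move=> a u v _ _; rewrite scaler0 addr0.
have c0 a : a \in d -> 0 \in c by move=> _; apply: sc.1.
have ker0 a : a \in d -> ((0 : F) == 0) = (a \in d) by move=> ->; rewrite eqxx.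
have := card_pi_preim sy sd; rewrite soc_eq.
case/(extend_into_divisible sy sc sd sd div dy (subxx d) lin0 c0 ker0).
move=> h [linh hd hc kerh].
pose f x := x + h x.
have linf : lin_on y f.
  by move=> a u v yu yv; rewrite /f linh // scalerDr addrACA.
exists f; split=> //.
  apply: (lin_on_inj sy linf) => x yx /eqP E.
  have yh : h x \in y.
    by move: E; rewrite /f addrC addr_eq0 => /eqP->; rewrite -scaleN1r submodZ.
  have h0 : h x = 0 by apply: yc0 => //; apply: hc.
  by move: E; rewrite /f h0 addr0 => /eqP.
apply/setP=> z; rewrite inE; apply/andP/idP=> [[yz /imsetP[x yx Ez]] | dz].
  have yh : h x \in y by rewrite -(addKr x (h x)) addrC submodB // -/(f x) -Ez.
  have h0 : h x = 0 by apply: yc0 => //; apply: hc.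
  by rewrite Ez /f h0 addr0 -kerh ?h0.
have yz := subsetP dy z dz; split=> //; apply/imsetP; exists z => //.
by rewrite /f hd // addr0.
Qed.

(** Linear maps that agree on the intersection of w and z glue on the sum. *)
Lemma glue_linear w z f g :
    is_submod w -> is_submod z -> lin_on w f -> lin_on z g ->
    {in w :&: z, f =1 g} ->
  exists h, [/\ lin_on [set a + b | a in w, b in z] h,
                {in w, h =1 f} & {in z, h =1 g}].
Proof.
move=> sw sz linf ling E.
have [|y|h hP] := @linear_relation_fun F F
    (fun x y => exists a b, [/\ a \in w, b \in z, x = a + b & y = f a + g b]).
- move=> r x x' y y' [a [b [wa zb -> ->]]] [a' [b' [wa' zb' -> ->]]].
  exists (r *: a + a'), (r *: b + b'); rewrite sw.2 // sz.2 //; split=> //.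
    by rewrite scalerDr addrACA.
  by rewrite linf // ling // scalerDr addrACA.
- case=> a [b [wa zb /esym/eqP E0 ->]]; move: E0; rewrite addr_eq0 => /eqP Ea.
  have za : a \in z by rewrite Ea -scaleN1r submodZ.
  have -> : b = - a by rewrite Ea opprK.
  rewrite E ?inE ?wa // -[- a]scaleN1r (lin_onZ (-1) sz) // scaleN1r.
  exact: subrr.
have hE a b : a \in w -> b \in z -> h (a + b) = f a + g b.
  by move=> wa zb; apply: hP; exists a, b.
exists h; split=> [r x y|a wa|b zb].
- case/imset2P=> a b wa zb -> /imset2P[a' b' wa' zb' ->].
  rewrite scalerDr addrACA !hE ?sw.2 ?sz.2 // linf // ling //.
  by rewrite scalerDr addrACA.
- by have := hE a 0 wa sz.1; rewrite (lin_on0 sz ling) !addr0.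
by have := hE 0 b sw.1 zb; rewrite (lin_on0 sw linf) !add0r.
Qed.

End Uniformizer.
End FiniteModule.
End LinearRelations.

(** * Types of finite modules *)

Section Bases.
Variables (O : idomainType) (pi : O).

(** The ideal generated by pi ^+ j. *)
Definition pdvd j a := exists b, a = pi ^+ j * b.

Lemma pdvd0 j : pdvd j 0. Proof. by exists 0; rewrite mulr0. Qed.

(** The powers of the ideal generated by pi. *)
Lemma ideal_expE (P : O -> Prop) j a :
  (forall x, P x <-> exists b, x = pi * b) -> ideal_exp P j a <-> pdvd j a.
Proof.
move=> PE; split=> [Pa | [b ->] J [_ _ JM] Jprod].
  apply: Pa => [|t /(_ _)/PE Pt].
    split=> [|x y [b ->] [c ->]|c x [b ->]]; first exact: pdvd0.
      by exists (b + c); rewrite mulrDr.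
    by exists (c * b); rewrite mulrCA.
  have /choice[b tE] := Pt; exists (\prod_i b i).
  by rewrite (eq_bigr _ (fun i _ => tE i)) big_split prodr_const card_ord.
rewrite mulrC; apply: JM.
rewrite -[X in _ ^+ X]card_ord -prodr_const; apply: Jprod => i.
by apply/PE; exists 1; rewrite mulr1.
Qed.

Hypothesis pi_nz : pi != 0.

Lemma pdvd_mul i j a : pdvd (i + j) (pi ^+ i * a) -> pdvd j a.
Proof.
case=> b; rewrite exprD -mulrA => /(mulfI (expf_neq0 i pi_nz)) ->.
by exists b.
Qed.

Lemma pdvdW i j a : (i <= j)%N -> pdvd j a -> pdvd i a.
Proof.
move=> le [b ->]; exists (pi ^+ (j - i) * b).
by rewrite mulrA -exprD subnKC.
Qed.

(** Families of scalars are indexed by nat; this extends by 0 a family indexed by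
    ordinals. *)
Definition ord_ext l (a : 'I_l -> O) (i : nat) : O := oapp a 0 (insub i).

Lemma ord_extE l (a : 'I_l -> O) (i : 'I_l) : ord_ext a i = a i.
Proof. by rewrite /ord_ext valK. Qed.

Section Module.
Variable F : finLmodType O.
Implicit Types (A B : {set F}) (v w : nat -> F) (la mu : seq nat) (c : nat -> O).

(** The combination of the first l vectors of v with coefficients c. *)
Definition comb l v c : F := \sum_(i < l) c i *: v i.

(** A is the direct sum of the cyclic modules O v_i for i < size la, and the
    annihilator of v_i is generated by pi ^+ la_i. *)
Definition is_basis A la v :=
  (forall x, x \in A <-> exists c, x = comb (size la) v c) /\
  (forall c, comb (size la) v c = 0 <->
             forall i, (i < size la)%N -> pdvd (nth 0%N la i) (c i)).

(** A is isomorphic to the sum of the O / pi ^+ la_i. *)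
Definition typed A la := exists v, is_basis A la v.

Lemma comb_eq l v c c' :
  (forall i, (i < l)%N -> c i = c' i) -> comb l v c = comb l v c'.
Proof. by move=> E; apply: eq_bigr => i _; rewrite E. Qed.

Lemma combZD l v r c c' :
  comb l v (fun i => r * c i + c' i) = r *: comb l v c + comb l v c'.
Proof.
rewrite scaler_sumr -big_split; apply: eq_bigr => i _ /=.
by rewrite scalerDl scalerA.
Qed.

Lemma combZ l v r c : comb l v (fun i => r * c i) = r *: comb l v c.
Proof. by rewrite scaler_sumr; apply: eq_bigr => i _; rewrite scalerA. Qed.

Lemma combB l v c c' : comb l v (fun i => c i - c' i) = comb l v c - comb l v c'.
Proof.
rewrite /comb -sumrB; apply: eq_bigr => i _.
by rewrite scalerBl.
Qed.

Lemma comb_delta l v i : (i < l)%N -> comb l v (fun j => (j == i)%:R) = v i.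
Proof.
move=> lti; rewrite /comb (bigD1 (Ordinal lti)) //= eqxx scale1r.
rewrite big1 ?addr0 // => j.
by rewrite -val_eqE /= => /negbTE ->; rewrite scale0r.
Qed.

Lemma comb_ord_ext l v (a : 'I_l -> O) : comb l v (ord_ext a) = \sum_i a i *: v i.
Proof. by apply: eq_bigr => i _; rewrite ord_extE. Qed.

Lemma basis_submod A la v : is_basis A la v -> is_submod A.
Proof.
case=> AE _; split=> [|a x y /AE[c ->] /AE[c' ->]].
  by apply/AE; exists (fun=> 0); rewrite /comb big1 // => i _; rewrite scale0r.
by apply/AE; exists (fun i => a * c i + c' i); rewrite combZD.
Qed.

Lemma typed_submod A la : typed A la -> is_submod A.
Proof. by case=> v /basis_submod. Qed.

Lemma basis_gen_mem A la v i : is_basis A la v -> (i < size la)%N -> v i \in A.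
Proof. by case=> AE _ lti; apply/AE; eexists; rewrite -(comb_delta v lti). Qed.

Lemma submod_typeP (P : O -> Prop) A la :
  (forall x, P x <-> exists b, x = pi * b) ->
  submod_type P (fun x => x \in A) la <-> typed A la.
Proof.
move=> PE; split=> [[f [AE f0]] | [v [AE v0]]].
  exists (fun i => oapp (fun i : 'I_(size la) => f (delta_mx 0 i)) 0 (insub i)).
  set v := fun _ => _.
  have fE c : comb (size la) v c = f (\row_i c i).
    rewrite [X in f X]row_sum_delta linear_sum; apply: eq_bigr => i _.
    by rewrite linearZ /v valK mxE.
  split=> [x|c].
    rewrite AE; split=> [[a ->] | [c ->]]; last by exists (\row_i c i); rewrite fE.
    exists (ord_ext (a 0)); rewrite fE; congr (f _).
    by apply/rowP=> i; rewrite mxE ord_extE.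
  rewrite fE f0; split=> [H i lti | H i].
    by have /(ideal_expE _ _ PE) := H (Ordinal lti); rewrite mxE.
  by apply/(ideal_expE _ _ PE); rewrite mxE; apply: H.
pose f0 (a : 'rV[O]_(size la)) : F := \sum_i a 0 i *: v i.
have linf : linear f0.
  move=> r a b; rewrite /f0 scaler_sumr -big_split; apply: eq_bigr => i _ /=.
  by rewrite !mxE scalerDl scalerA.
pose f : {linear 'rV[O]_(size la) -> F} :=
  HB.pack f0 (GRing.isLinear.Build _ _ _ _ f0 linf).
exists f; rewrite /f /=.
split=> [x|a].
  rewrite AE; split=> [[c ->]|[a ->]].
    by exists (\row_i c i); apply: eq_bigr => i _; rewrite mxE.
  by exists (ord_ext (a 0)); rewrite comb_ord_ext.
have -> : f0 a = comb (size la) v (ord_ext (a 0)) by rewrite comb_ord_ext.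
rewrite v0; split=> [H i | H i lti].
  by apply/(ideal_expE _ _ PE); have := H i (ltn_ord i); rewrite ord_extE.
have := H (Ordinal lti); rewrite -(ord_extE (a 0) (Ordinal lti)).
by move/(ideal_expE _ _ PE).
Qed.

End Module.

Section Residues.
Hypothesis pi_nunit : ~ pdvd 1 1.
Variables (q : nat) (rep : 'I_q -> O).
Hypothesis rep_onto : forall x, exists i, pdvd 1 (x - rep i).
Hypothesis rep_inj : forall i j, pdvd 1 (rep i - rep j) -> i = j.

Lemma residues_gt1 : (1 < q)%N.
Proof.
have [i [b Ei]] := rep_onto 0; have [j [c Ej]] := rep_onto 1.
rewrite ltnNge; apply/negP=> le1; apply: pi_nunit.
have E : i = j.
  apply: val_inj => /=; have := ltn_ord i; have := ltn_ord j.
  by case: (q) i j le1 {Ei Ej} => [|[|//]] [[|//] ?] [[|//] ?].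
exists (c - b); rewrite mulrBr -Ei -Ej E sub0r opprK subrK //.
Qed.

Variable F : finLmodType O.
Implicit Types (A B : {set F}).

(** The elements of the socle of A that are divisible by pi ^+ j in A. *)
Definition deep_socle A j :=
  [set x in socle pi A | [exists y in A, x == pi ^+ j *: y]].

(** For j < la_i the vector pi ^+ (la_i).-1 v_i is in the socle and divisible by
    pi ^+ j; these vectors form a basis over the residue field, of which q is the
    number of elements. *)
Lemma card_deep_socle A la j : typed A la ->
  #|deep_socle A j| = (q ^ count (ltn j) la)%N.
Proof.
case=> v [AE v0]; set l := size la.
have q_gt0 : (0 < q)%N := ltnW residues_gt1.
pose c0 : 'I_q := Ordinal q_gt0.
pose D := [pred i : 'I_l | (j < nth 0%N la i)%N].
pose coef (c : {ffun 'I_l -> 'I_q}) (i : 'I_l) : O :=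
  if (j < nth 0%N la i)%N then pi ^+ (nth 0%N la i).-1 * rep (c i) else 0.
pose phi c := comb l v (ord_ext (coef c)).
have -> : count (ltn j) la = #|D|.
  rewrite -sum1_card -sum1_count (big_nth 0%N) big_mkord.
  by apply: eq_bigl => i.
rewrite -{1}(card_ord q) -(card_pffun_on c0 D predT) -(card_in_imset (f := phi)).
  apply: eq_card => x; apply/setIdP/imsetP=> [[]|[c _ ->]].
    rewrite inE => /andP[/AE[d Ed] /eqP px] /existsP[y /andP[/AE[e Ey] /eqP Exy]].
    have Ed' : x = comb l v (fun i => pi ^+ j * e i) by rewrite combZ -Ey.
    have pe i : (i < l)%N -> pdvd (nth 0%N la i) (pi ^+ j.+1 * e i).
      move=> lti; have /v0 : comb l v (fun i => pi * (pi ^+ j * e i)) = 0.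
        by rewrite combZ -Ed'.
      by move/(_ i lti); rewrite mulrA -exprS.
    have /choice[f fP] (i : 'I_l) : exists s : 'I_q,
        if (j < nth 0%N la i)%N then
          pdvd (nth 0%N la i) (pi ^+ j * e i - pi ^+ (nth 0%N la i).-1 * rep s)
        else s = c0.
      case lt_j: (j < nth 0%N la i)%N; last by exists c0.
      have [b Eb] : pdvd ((nth 0%N la i).-1 - j) (e i).
        apply: (@pdvd_mul j.+1).
        rewrite addSn subnKC; last by rewrite -ltnS (ltn_predK lt_j).
        by rewrite (ltn_predK lt_j); apply: pe.
      have [s [b' Es]] := rep_onto b; exists s, b'.
      have Ela : nth 0%N la i = (nth 0%N la i).-1.+1 by rewrite (ltn_predK lt_j).
      rewrite Eb mulrA -exprD subnKC; last by rewrite Ela in lt_j.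
      by rewrite -mulrBr Es [in RHS]Ela expr1 [in RHS]exprSr -mulrA.
    exists [ffun i => f i].
      apply/pffun_onP; split=> //; apply/subsetP=> i; rewrite !inE ffunE.
      by have := fP i; case: ifP => // _ ->; rewrite eqxx.
    rewrite Ed' /phi; apply/eqP; rewrite -subr_eq0 -combB; apply/eqP/v0 => i lti.
    rewrite (ord_extE _ (Ordinal lti)) /coef /= ffunE.
    have := fP (Ordinal lti); case: ifP => //= nlt _; rewrite subr0.
    apply: pdvdW (_ : pdvd j _); last by exists (e i).
    by rewrite leqNgt nlt.
  have pphi : pi *: phi c = 0.
    rewrite -combZ; apply/v0 => i lti; rewrite (ord_extE _ (Ordinal lti)) /coef /=.
    case: ifP => [lt_j|_]; last by rewrite mulr0; apply: pdvd0.
    exists (rep (c (Ordinal lti))); rewrite mulrA -exprS.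
    by rewrite (ltn_predK lt_j).
  split; first by rewrite inE pphi eqxx andbT; apply/AE; eexists.
  pose e (i : 'I_l) := if (j < nth 0%N la i)%N
    then pi ^+ ((nth 0%N la i).-1 - j) * rep (c i) else 0.
  apply/existsP; exists (comb l v (ord_ext e)); apply/andP; split.
    by apply/AE; eexists.
  apply/eqP; rewrite -combZ; apply: comb_eq => i lti.
  rewrite !(ord_extE _ (Ordinal lti)) /coef /e /=.
  case: ifP => [lt_j|_]; last by rewrite mulr0.
  by rewrite mulrA -exprD subnKC // -ltnS (ltn_predK lt_j).
move=> c c' /pffun_onP[/subsetP sc _] /pffun_onP[/subsetP sc' _].
rewrite /phi => /eqP; rewrite -subr_eq0 -combB => /eqP/v0 H.
apply/ffunP=> i; have := H i (ltn_ord i); rewrite !ord_extE /coef.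
case: ifP => [lt_j | nlt _]; last first.
  have out (d : {ffun 'I_l -> 'I_q}) : {subset (support_for c0 d) <= D} -> d i = c0.
    move=> sd; apply/eqP; apply: contraFT nlt => ne.
    by have := sd i; rewrite !inE; apply.
  by rewrite !out.
rewrite -mulrBr -[X in pdvd X](ltn_predK lt_j) -addn1 => /pdvd_mul.
exact: rep_inj.
Qed.

(** The number of parts greater than j is determined by A, for every j. *)
Lemma typed_uniq A la mu : is_partition la -> is_partition mu ->
  typed A la -> typed A mu -> la = mu.
Proof.
case/andP=> sla la0 /andP[smu mu0] tla tmu.
have E j : count (ltn j) la = count (ltn j) mu.
  apply/eqP; rewrite -(eqn_exp2l _ _ residues_gt1).
  by rewrite -(card_deep_socle j tla) -(card_deep_socle j tmu).
have geq_trans : transitive geq by move=> a b c /= ab bc; apply: leq_trans bc ab.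
have geq_anti : antisymmetric geq by move=> a b; rewrite andbC => /anti_leq.
apply: (sorted_eq geq_trans geq_anti sla smu).
apply/allP=> j _ /=; apply/eqP.
have cE s : 0%N \notin s -> (count_mem j s + count (ltn j) s)%N =
   if j is i.+1 then count (ltn i) s else count (ltn 0) s.
  move=> s0; rewrite -count_predUI [X in (_ + X)%N](eq_count (a2 := pred0)).
    rewrite count_pred0 addn0; case: j => [|j].
      apply: eq_in_count => a sa /=; rewrite /predU /=.
      by case: a sa s0 => // ->.
    by apply: eq_count => a; rewrite /predU /= eq_sym -leq_eqVlt.
  by move=> a /=; case: eqP => // ->; rewrite /= ltnn.
apply: (@addIn (count (ltn j) la)); rewrite cE // [in RHS]E cE //.
by case: j {cE} => *; apply: E.
Qed.

End Residues.
End Bases.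

(** * The structure theorem *)

(** A finite set that meets all the residue classes can be thinned out to a
    system of representatives. *)
Lemma residues_exist (O : idomainType) (pi : O) (s : seq O) :
    (forall x, exists2 y, y \in s & pdvd pi 1 (x - y)) ->
  exists q (rep : 'I_q -> O), (forall x, exists i, pdvd pi 1 (x - rep i)) /\
    (forall i j, pdvd pi 1 (rep i - rep j) -> i = j).
Proof.
move=> s_onto.
have dvdB x y z : pdvd pi 1 (x - y) -> pdvd pi 1 (y - z) -> pdvd pi 1 (x - z).
  by case=> b Eb [c Ec]; exists (b + c); rewrite mulrDr -Eb -Ec addrA subrK.
have dvdN x y : pdvd pi 1 (x - y) -> pdvd pi 1 (y - x).
  by case=> b Eb; exists (- b); rewrite mulrN -Eb opprB.
suff [t [t_onto t_inj]] : exists t : seq O,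
    (forall x, x \in s -> exists2 i, (i < size t)%N & pdvd pi 1 (x - nth 0 t i)) /\
    (forall i j, (i < size t)%N -> (j < size t)%N ->
       pdvd pi 1 (nth 0 t i - nth 0 t j) -> i = j).
  exists (size t), (fun i => nth 0 t i).
  split=> [x | i j H]; last by apply: val_inj; apply: (t_inj _ _ _ _ H).
  have [y sy xy] := s_onto x; have [i lti yi] := t_onto y sy.
  by exists (Ordinal lti); apply: dvdB yi.
elim: s {s_onto} => [|a s [t [t_onto t_inj]]]; first by exists [::].
case: (pselect (exists2 i, (i < size t)%N & pdvd pi 1 (a - nth 0 t i))) => [ai|no].
  by exists t; split=> // x; rewrite inE => /orP[/eqP->|/t_onto].
exists (rcons t a); rewrite size_rcons; split=> [x | i j].
  rewrite inE => /orP[/eqP->|/t_onto[i lti xi]].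
    by exists (size t); rewrite // nth_rcons ltnn eqxx subrr; apply: pdvd0.
  by exists i; rewrite ?ltnS 1?ltnW // nth_rcons lti.
rewrite !ltnS !nth_rcons [(i <= _)%N]leq_eqVlt [(j <= _)%N]leq_eqVlt.
move=> /orP[/eqP-> | lti] /orP[/eqP-> | ltj] //.
- by rewrite ltnn eqxx ltj => H; case: no; exists j.
- by rewrite ltnn eqxx lti => /dvdN H; case: no; exists i.
by rewrite lti ltj; apply: t_inj.
Qed.

Section Types.
Variables (O : idomainType) (pi : O) (k : nat) (F : finLmodType O).
Hypothesis pi_nz : pi != 0.
Hypothesis local_pi : forall a, (exists b, a = pi * b) \/
  exists b c, a * b = 1 - pi ^+ k * c.
Hypothesis piF : forall x : F, pi ^+ k *: x = 0.
Implicit Types (A B : {set F}) (v w : nat -> F) (la mu : seq nat).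

Local Notation is_basis := (is_basis pi).
Local Notation typed := (typed pi).
Local Notation socle := (socle pi).

(** Adding to B an element of the socle outside B adds a part equal to 1. *)
Lemma basis_append B la v t : is_basis B la v -> t \notin B -> pi *: t = 0 ->
  is_basis (adjoin B t) (rcons la 1) (fun i => if i == size la then t else v i).
Proof.
move=> bas nBt pt; have sB := basis_submod bas; have [BE v0] := bas.
set v' := fun i => _.
have combE c :
    comb (size (rcons la 1)) v' c = c (size la) *: t + comb (size la) v c.
  rewrite size_rcons /comb big_ord_recr /= {2}/v' eqxx addrC; congr (_ + _).
  by apply: eq_bigr => i _; rewrite /v' ltn_eqF.
split=> [x | c].
  split=> [/adjoinP[r [_ [/BE[c ->] ->]]] | [c ->]].
    exists (fun i => if i == size la then r else c i).
    rewrite combE eqxx; congr (_ + _).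
    by apply: eq_bigr => i _; rewrite ltn_eqF.
  rewrite combE; apply/adjoinP; exists (c (size la)), (comb (size la) v c).
  by split=> //; apply/BE; exists c.
rewrite combE size_rcons; split=> [E i | H].
  have [r Er] : exists r, c (size la) = pi * r.
    apply: (nonmember_pi local_pi piF sB nBt).
    move/eqP: E; rewrite addr_eq0 => /eqP->; rewrite -scaleN1r.
    by apply: submodZ => //; apply/BE; exists c.
  move: E; rewrite Er mulrC -scalerA pt scaler0 add0r => /v0 E.
  rewrite ltnS leq_eqVlt nth_rcons; case: eqP => [-> _ | _ /= lti].
    by rewrite ltnn; exists r.
  by rewrite lti; apply: E.
have [r ->] : exists r, c (size la) = pi * r.
  have := H (size la) (ltnSn _); rewrite nth_rcons ltnn eqxx => -[r ->].
  by exists r.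
rewrite mulrC -scalerA pt scaler0 add0r; apply/v0 => i lti.
by have := H i (ltnW lti); rewrite nth_rcons lti.
Qed.

Lemma partition_append la : is_partition la -> is_partition (rcons la 1).
Proof.
rewrite /is_partition mem_rcons inE negb_or => /andP[sla la0].
apply/andP; split; last exact/andP.
case: la sla la0 => //= a la sla la0; rewrite rcons_path sla /=.
rewrite lt0n; apply: contraNneq la0 => <-; exact: mem_last.
Qed.

Lemma basis_saturate A B la v : is_submod A -> is_basis B la v -> B \subset A ->
    is_partition la ->
  exists B' la' v', [/\ is_basis B' la' v', B \subset B', B' \subset A,
                        socle A \subset B' & is_partition la'].
Proof.
move=> sA; have [j] := ubnP (#|A| - #|B|)%N.
elim: j B la v => // j IHj B la v /ltnSE lej bas sBA par.
have [sSB | /subsetPn[t]] := boolP (socle A \subset B); first by exists B, la, v.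
rewrite inE => /andP[At /eqP pt] nBt.
have sB := basis_submod bas.
have sB'A : adjoin B t \subset A.
  apply/subsetP=> x /adjoinP[r [a [Ba ->]]].
  by apply: sA.2 => //; apply: (subsetP sBA).
have ltB : (#|B| < #|adjoin B t|)%N.
  apply: proper_card; apply/properP; split; first exact: sub_adjoin.
  by exists t => //; apply: mem_adjoin.
have [|B' [la' [v' [bas' sub1 sub2 soc par']]]] :=
    IHj _ _ _ _ (basis_append bas nBt pt) sB'A (partition_append par).
  apply: leq_trans lej; apply: ltn_sub2l => //.
  exact: leq_trans ltB (subset_leq_card sB'A).
exists B', la', v'; split=> //; apply: subset_trans sub1; exact: sub_adjoin.
Qed.

(** By induction on the exponent: divide by pi the vectors of a basis of pi A,
    which increases the parts by 1, then add elements of the socle until it is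
    exhausted. *)
Lemma typed_exists A : is_submod A -> exists2 la, is_partition la & typed A la.
Proof.
have piA x : x \in A -> pi ^+ k *: x = 0 by [].
elim: k A piA => [|j IHj] A piA sA.
  exists [::] => //; exists (fun=> 0); split=> [x|c]; last first.
    by rewrite /comb big_ord0; split.
  split=> [/piA | [c ->]]; last by rewrite /comb big_ord0 sA.1.
  by rewrite expr0 scale1r => ->; exists (fun=> 0); rewrite /comb big_ord0.
have linpi : lin_on A (fun x => pi *: x).
  by move=> a x y _ _; rewrite scalerDr !scalerA mulrC.
pose C := [set pi *: x | x in A].
have [||la par [w [CE w0]]] := IHj C; last 1 first.
- have sw i : exists x, (i < size la)%N -> x \in A /\ pi *: x = w i.
    case lti: (i < size la)%N; last by exists 0.
    have /imsetP[x Ax ->] := basis_gen_mem (conj CE w0) lti.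
    by exists x.
  have [v vP] := choice sw.
  have pv c : pi *: comb (size la) v c = comb (size la) w c.
    rewrite scaler_sumr; apply: eq_bigr => i _.
    by rewrite scalerA mulrC -scalerA (vP i _).2.
  have la_gt0 i : (i < size la)%N -> (0 < nth 0%N la i)%N.
    case/andP: par => _ la0 lti; rewrite lt0n.
    by apply: contraNneq la0 => <-; apply: mem_nth.
  have v0 c : comb (size la) v c = 0 <->
      forall i, (i < size la)%N -> pdvd pi (nth 0%N la i).+1 (c i).
    split=> [E i lti | H].
      have /choice[d dP] i' : exists d, (i' < size la)%N -> c i' = pi * d.
        case lti': (i' < size la)%N; last by exists 0.
        have /w0/(_ i' lti') : comb (size la) w c = 0 by rewrite -pv E scaler0.
        by move/(pdvdW (la_gt0 i' lti'))=> [d ->]; exists d.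
      have /w0/(_ i lti)[b Eb] : comb (size la) w d = 0.
        rewrite -E; apply: eq_bigr => i' _; rewrite dP // -(vP i' _).2 //.
        by rewrite scalerA mulrC.
      by exists b; rewrite dP // Eb exprS mulrA.
    have /choice[d dP] i' : exists d,
        (i' < size la)%N -> c i' = pi ^+ (nth 0%N la i').+1 * d.
      case lti': (i' < size la)%N; last by exists 0.
      by have [d ->] := H i' lti'; exists d.
    have <- : comb (size la) w (fun i => pi ^+ (nth 0%N la i) * d i) = 0.
      by apply/w0=> i lti; exists (d i).
    apply: eq_bigr => i _; rewrite dP // -(vP i _).2 // scalerA.
    by rewrite exprSr -!mulrA [d i * _]mulrC.
  pose B := [set x | `[< exists c, x = comb (size la) v c >]].
  have bas : is_basis B (map S la) v.
    split=> [x | c]; rewrite size_map; first by rewrite inE; split=> /asboolP.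
    rewrite v0; split=> H i lti; first by rewrite (nth_map 0%N) //; apply: H.
    by have := H i lti; rewrite (nth_map 0%N).
  have sBA : B \subset A.
    apply/subsetP=> x; rewrite inE => /asboolP[c ->].
    apply: (big_ind (fun x => x \in A)) => [|x1 x2|i _].
    - exact: sA.1.
    - exact: submodD.
    by apply: submodZ => //; apply: (vP i _).1.
  have parS : is_partition (map S la).
    case/andP: par => sla _; apply/andP; split.
      by apply: (homo_sorted (e := geq)) sla => a b.
    by apply/negP=> /mapP[].
  have [B' [la' [v' [bas' sBB' sB'A soc par']]]] := basis_saturate sA bas sBA parS.
  exists la' => //; exists v'.
  (* A = B + socle A, as pi B = pi A *)
  suff -> : A = B' by [].
  apply/eqP; rewrite eqEsubset sB'A andbT; apply/subsetP=> x Ax.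
  have /CE[c Ec] : pi *: x \in C by apply/imsetP; exists x.
  have Bc : comb (size la) v c \in B by rewrite inE; apply/asboolP; exists c.
  rewrite -(subrK (comb (size la) v c) x).
  apply: submodD (basis_submod bas') _ _; last exact: (subsetP sBB').
  apply: (subsetP soc); rewrite inE scalerBr pv Ec subrr eqxx andbT.
  by apply: submodB => //; apply: (subsetP sBA).
- by move=> _ /imsetP[x Ax ->]; rewrite scalerA -exprSr; apply: piA.
exact: submod_imset sA linpi.
Qed.

Lemma free_divisible (y : {set F}) m :
  (0 < k)%N -> typed y (nseq m k) -> divisible pi k y.
Proof.
move=> k_gt0 [v [yE v0]] x /yE[c ->]; rewrite -combZ => /v0 H.
rewrite size_nseq in H.
have /choice[d dP] i : exists d, (i < m)%N -> c i = pi * d.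
  case lti: (i < m)%N; last by exists 0.
  have := H i lti; rewrite nth_nseq lti -[X in pdvd pi X](prednK k_gt0) -addn1.
  by move/(pdvd_mul pi_nz)=> [d ->]; exists d.
exists (comb (size (nseq m k)) v d); first by apply/yE; exists d.
by rewrite -combZ; apply: comb_eq => i; rewrite size_nseq => /dP.
Qed.

Lemma typed_iso A B la : typed A la -> typed B la ->
  exists f : F -> F, [/\ lin_on A f, {in A &, injective f} & f @: A = B].
Proof.
move=> tA tB; have sA := typed_submod tA; move: tA tB.
case=> v [AE v0] [w [BE w0]].
have [|y [c [/esym/v0 E ->]]|h hP] := @linear_relation_fun O F F
    (fun x y => exists c, x = comb (size la) v c /\ y = comb (size la) w c).
- move=> a x x' y y' [c [-> ->]] [c' [-> ->]].
  by exists (fun i => a * c i + c' i); rewrite !combZD.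
- by apply/w0.
have hE c : h (comb (size la) v c) = comb (size la) w c by apply: hP; exists c.
have linh : lin_on A h.
  by move=> a x y /AE[c ->] /AE[c' ->]; rewrite -combZD !hE combZD.
exists h; split=> //.
  apply: (lin_on_inj sA linh) => x /AE[c ->]; rewrite hE => /w0 E.
  exact/v0.
apply/setP=> y; apply/imsetP/idP=> [[x /AE[c ->] ->] | /BE[c ->]].
  by rewrite hE; apply/BE; exists c.
by exists (comb (size la) v c); rewrite ?hE //; apply/AE; exists c.
Qed.

End Types.

(** * Embeddings and submodules *)

Section SubmoduleType.
Variables (O : idomainType) (M : lmodType O) (d : {pred M}).

(* d as a predicate that carries the proof of its closure *)
Definition closed_pred of GRing.submod_closed d : {pred M} := d.
Variable cd : GRing.submod_closed d.
HB.instance Definition _ := GRing.isSubmodClosed.Build O M (closed_pred cd) cd.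

(** The submodule d of M, as a module. *)
Record sub_module :=
  SubModule {sub_val :> M; sub_valP : sub_val \in closed_pred cd}.
HB.instance Definition _ := [isSub for sub_val].
HB.instance Definition _ := [Choice of sub_module by <:].
HB.instance Definition _ := [SubChoice_isSubLmodule of sub_module by <:].

End SubmoduleType.

Definition build_linear (O : idomainType) (M N : lmodType O) (f : M -> N)
    (linf : linear f) : {linear M -> N} :=
  HB.pack f (GRing.isLinear.Build _ _ _ _ f linf).

Section Transport.
Variable O : idomainType.
Implicit Types L M N : lmodType O.

(** The image of f. *)
Definition image_pred M N (f : M -> N) (y : N) : Prop := exists x, y = f x.

(** A linear map whose values lie in the image of an injective linear map
    factors through the latter. *)
Lemma linear_factor L M N (f : {linear L -> N}) (h : {linear M -> N}) :
    injective h -> (forall x, image_pred h (f x)) ->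
  exists g : {linear L -> M}, forall x, h (g x) = f x.
Proof.
move=> injh /choice[g gP]; have lin_g : linear g.
  by move=> a x y; apply: injh; rewrite linearP -!gP linearP.
by exists (build_linear lin_g) => x; rewrite -gP.
Qed.

(** An automorphism g of N carrying the image of f to that of f' induces an
    isomorphism from M to M'. *)
Lemma linear_lift M (M' : lmodType O) N (f : {linear M -> N})
    (f' : {linear M' -> N}) (g : N -> N) :
    linear g -> injective g -> injective f -> injective f' ->
    (forall x, image_pred f' (g (f x))) -> (forall x', exists x, g (f x) = f' x') ->
  exists2 h : {linear M -> M'}, bijective h & forall x, f' (h x) = g (f x).
Proof.
move=> ling injg injf injf' im im'.
have lin_gf : linear (g \o f) by move=> a x y /=; rewrite linearP ling.
have [|h hE] := linear_factor (f := build_linear lin_gf) injf'; first exact: im.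
exists h => //.
have /choice[h' h'P] := im'; exists h' => [x | x'].
  by apply/injf/injg; rewrite h'P hE.
by apply: injf'; rewrite hE /= h'P.
Qed.

Lemma has_type_image (P : O -> Prop) M N la (f : {linear M -> N}) :
  injective f -> has_type P M la -> submod_type P (image_pred f) la.
Proof.
move=> injf [h [im_h ker_h]].
have lin_fh : linear (f \o h) by move=> a x y /=; rewrite !linearP.
exists (build_linear lin_fh); split=> [y|a].
  split=> [[x ->]|[a ->]]; last by exists (h a).
  by have [a ->] := (im_h x).1 I; exists a.
rewrite -ker_h /=; split=> [E | ->]; last by rewrite linear0.
by apply: injf; rewrite E linear0.
Qed.

Lemma has_type_iso (P : O -> Prop) M N (Y : N -> Prop) la :
    has_type P M la -> submod_type P Y la ->
  exists f : {linear M -> N}, injective f /\ forall y, Y y <-> image_pred f y.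
Proof.
move=> [h [im_h ker_h]] [h' [im_h' ker_h']].
have [|y [a [/esym E ->]]|f fP] := @linear_relation_fun O M N
    (fun x y => exists a, x = h a /\ y = h' a).
- move=> r x x' y y' [a [-> ->]] [a' [-> ->]].
  by exists (r *: a + a'); rewrite !linearP.
- exact/ker_h'/ker_h.
have fE a : f (h a) = h' a by apply: fP; exists a.
have h_onto x : exists a, x = h a by apply/im_h.
have linf : linear f.
  move=> r x y; have [a ->] := h_onto x; have [b ->] := h_onto y.
  by rewrite -linearP !fE linearP.
exists (build_linear linf); split=> [x y|y] /=.
  have [a ->] := h_onto x; have [b ->] := h_onto y; rewrite !fE => E.
  apply/eqP; rewrite -subr_eq0 -linearB; apply/eqP/ker_h/ker_h'.
  by rewrite linearB E subrr.
rewrite im_h'; split=> [[a ->]|[x ->]]; first by exists (h a); rewrite /= fE.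
by have [a ->] := h_onto x; exists a; rewrite /= fE.
Qed.

Lemma submod_type_eq (P : O -> Prop) M (X Y : M -> Prop) la :
  (forall x, X x <-> Y x) -> submod_type P X la -> submod_type P Y la.
Proof.
by move=> E [f [im ker]]; exists f; split=> // y; rewrite -E.
Qed.

Section FiniteAmbient.
Variable F : finLmodType O.
Implicit Types d w : {set F}.

Lemma is_submod_closed d : is_submod d -> GRing.submod_closed (mem d).
Proof. by case=> d0 lind; split=> // a x y; apply: lind. Qed.

(** The submodule d of F as a module, and its inclusion in F. *)
Definition as_module d (sd : is_submod d) : lmodType O :=
  sub_module (is_submod_closed sd).

Definition as_module_val d (sd : is_submod d) : {linear as_module sd -> F} :=
  \val : {linear sub_module (is_submod_closed sd) -> F}.

Lemma as_module_val_inj d (sd : is_submod d) : injective (as_module_val sd).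
Proof. exact: val_inj. Qed.

Lemma as_moduleP d (sd : is_submod d) x :
  x \in d <-> image_pred (as_module_val sd) x.
Proof.
split=> [dx | [y ->]]; last exact: sub_valP y.
have dx' : x \in closed_pred (is_submod_closed sd) by [].
by exists (SubModule dx').
Qed.

Lemma as_module_type (P : O -> Prop) d (sd : is_submod d) la :
  submod_type P (fun x => x \in d) la -> has_type P (as_module sd) la.
Proof.
case=> f [im_f ker_f].
have [|g gE] := linear_factor (f := f) (@as_module_val_inj d sd).
  by move=> a; apply/as_moduleP/im_f; exists a.
exists g; split=> [x|a].
  split=> // _; have dx : as_module_val sd x \in d by apply/as_moduleP; exists x.
  have [a Ea] := (im_f _).1 dx.
  by exists a; apply: (@as_module_val_inj d sd); rewrite gE.
rewrite -ker_f -gE; split=> [->|E]; first by rewrite linear0.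
by apply: (@as_module_val_inj d sd); rewrite E linear0.
Qed.

Lemma inclusion_exists d w (sd : is_submod d) (sw : is_submod w) : d \subset w ->
  exists2 i : {linear as_module sd -> as_module sw}, injective i &
    forall x, as_module_val sw (i x) = as_module_val sd x.
Proof.
move=> dw.
have [|i iE] := linear_factor (f := as_module_val sd) (@as_module_val_inj w sw).
  move=> x; apply/as_moduleP/(subsetP dw)/(as_moduleP sd); by exists x.
exists i => // x y E; apply: (@as_module_val_inj d sd).
by rewrite -!iE E.
Qed.

(** Through the injections f and g, the embedding i becomes the inclusion of the
    submodule d of F in the submodule w. *)
Definition realizes (P : O -> Prop) la nu (i : embedding P la nu)
    (f : {linear emb_src i -> F}) (g : {linear emb_tgt i -> F}) d w :=
  [/\ injective f, injective g, forall x, x \in d <-> image_pred f x,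
      forall x, x \in w <-> image_pred g x & forall x, g (i x) = f x].

Lemma inclusion_embedding (P : O -> Prop) d w la nu (sd : is_submod d)
    (sw : is_submod w) :
    submod_type P (fun x => x \in d) la -> submod_type P (fun x => x \in w) nu ->
    d \subset w ->
  exists (i : embedding P la nu) (f : {linear emb_src i -> F})
         (g : {linear emb_tgt i -> F}), realizes f g d w.
Proof.
move=> td tw dw; have [i inj_i iE] := inclusion_exists sd sw dw.
exists (Embedding inj_i (as_module_type sd td) (as_module_type sw tw)).
exists (as_module_val sd), (as_module_val sw); split=> //.
- exact: as_module_val_inj.
- exact: as_module_val_inj.
- exact: as_moduleP.
exact: as_moduleP.
Qed.

(** Every embedding is realized by the inclusion of a submodule of w, for any w
    of type nu. *)
Lemma embedding_inside (P : O -> Prop) w la nu (i : embedding P la nu) :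
    submod_type P (fun x => x \in w) nu ->
  exists d (f : {linear emb_src i -> F}) (g : {linear emb_tgt i -> F}),
    [/\ submod_type P (fun x => x \in d) la, d \subset w & realizes f g d w].
Proof.
move=> tw; have [g [inj_g gw]] := has_type_iso (emb_tgtP i) tw.
have lin_gi : linear (g \o i) by move=> a x y /=; rewrite !linearP.
pose f := build_linear lin_gi.
have inj_f : injective f by move=> x y /inj_g /(@emb_inj _ _ _ _ i).
pose d := [set x | `[< image_pred f x >]].
have dP x : x \in d <-> image_pred f x by rewrite inE; split=> /asboolP.
exists d, f, g; split=> //.
  apply: submod_type_eq (has_type_image inj_f (emb_srcP i)) => x.
  by split=> /dP.
by apply/subsetP=> x /dP[y ->]; apply/gw; exists (i y).
Qed.

(** Embeddings realized by submodules of w that an automorphism of F preserving w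
    exchanges are equivalent. *)
Lemma emb_equiv_of_perm (P : O -> Prop) la nu (i i' : embedding P la nu)
    (f : {linear emb_src i -> F}) (g : {linear emb_tgt i -> F})
    (f' : {linear emb_src i' -> F}) (g' : {linear emb_tgt i' -> F})
    d w d' (h : {perm F}) :
    realizes f g d w -> realizes f' g' d' w ->
    (forall a x y, h (a *: x + y) = a *: h x + h y) ->
    h @: d = d' -> h @: w = w -> emb_equiv i i'.
Proof.
move=> [inj_f inj_g dP wP gi] [inj_f' inj_g' dP' wP' gi'] linh hd hw.
have [||a bij_a aE] := linear_lift linh (@perm_inj _ h) inj_f inj_f'.
- by move=> x; apply/dP'; rewrite -hd imset_f //; apply/dP; exists x.
- move=> x'; have : f' x' \in d' by apply/dP'; exists x'.
  by rewrite -hd => /imsetP[_ /dP[x ->] ->]; exists x.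
have [||b bij_b bE] := linear_lift linh (@perm_inj _ h) inj_g inj_g'.
- by move=> x; apply/wP'; rewrite -hw imset_f //; apply/wP; exists x.
- move=> x'; have : g' x' \in w by apply/wP'; exists x'.
  by rewrite -hw => /imsetP[_ /wP[x ->] ->]; exists x.
exists a, b; split=> // x; apply: inj_g'.
by rewrite bE gi' aE gi.
Qed.

(** Conversely, an equivalence induces an automorphism of w. *)
Lemma lin_on_of_emb_equiv (P : O -> Prop) la nu (i i' : embedding P la nu)
    (f : {linear emb_src i -> F}) (g : {linear emb_tgt i -> F})
    (f' : {linear emb_src i' -> F}) (g' : {linear emb_tgt i' -> F}) d w d' :
    realizes f g d w -> realizes f' g' d' w -> emb_equiv i i' ->
  exists h, [/\ lin_on w h, {in w &, injective h}, h @: w = w & h @: d = d'].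
Proof.
move=> [inj_f inj_g dP wP gi] [inj_f' inj_g' dP' wP' gi'] [a [b [bij_a bij_b ab]]].
have [|y [x [/esym E ->]]|h hP] := @linear_relation_fun O F F
    (fun x y => exists z, x = g z /\ y = g' (b z)).
- move=> r x x' y y' [z [-> ->]] [z' [-> ->]].
  by exists (r *: z + z'); rewrite !linearP.
- have -> : x = 0 by apply: inj_g; rewrite E linear0.
  by rewrite !linear0.
have hE z : h (g z) = g' (b z) by apply: hP; exists z.
exists h; split.
- by move=> r x y /wP[z ->] /wP[z' ->]; rewrite -linearP !hE !linearP.
- move=> x y /wP[z ->] /wP[z' ->]; rewrite !hE => /inj_g' /(bij_inj bij_b) -> //.
- have [b' _ b'K] := bij_b; apply/setP=> y.
  apply/imsetP/idP=> [[_ /wP[z ->] ->] | /wP'[z ->]].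
    by rewrite hE; apply/wP'; exists (b z).
  by exists (g (b' z)); [apply/wP; exists (b' z) | rewrite hE b'K].
have [a' _ a'K] := bij_a; apply/setP=> y.
apply/imsetP/idP=> [[_ /dP[z ->] ->] | /dP'[z ->]].
  by rewrite -gi hE ab gi'; apply/dP'; exists (a z).
exists (f (a' z)); first by apply/dP; exists (a' z).
by rewrite -gi hE ab gi' a'K.
Qed.

End FiniteAmbient.
End Transport.

(** * Discrete valuation rings and free modules *)

(** A generator pi of the maximal ideal; modulo the powers of pi, an element
    outside the ideal is invertible, by the geometric series. *)
Lemma dvr_uniformizer (O : idomainType) (P : O -> Prop) : is_dvr P ->
  exists pi, [/\ pi != 0, forall x, P x <-> exists b, x = pi * b, ~ pdvd pi 1 1 &
    forall k a, (exists b, a = pi * b) \/ exists b c, a * b = 1 - pi ^+ k * c].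
Proof.
case=> [[idP nP1 maxP] _ [x0 Px0 nz0] princ].
have [pi piE] := princ P idP; have PE x : P x <-> exists b, x = pi * b.
  by rewrite piE; split=> -[b ->]; exists b; rewrite mulrC.
exists pi; split=> //.
- by apply: contraNneq nz0 => pi0; have [b ->] := (PE x0).1 Px0; rewrite pi0 mul0r.
- by move=> p1; apply/nP1/PE.
move=> k a; case: (pselect (P a)) => [/PE|nPa]; [by left | right].
have [P0 PD PM] := idP.
pose J x := exists y b, P y /\ x = y + b * a.
have idJ : is_ideal J.
  split=> [|x x' [y [b [Py ->]]] [y' [b' [Py' ->]]]|c x [y [b [Py ->]]]].
  - by exists 0, 0; rewrite mul0r addr0.
  - by exists (y + y'), (b + b'); rewrite mulrDl addrACA; split=> //; apply: PD.
  by exists (c * y), (c * b); rewrite mulrDr mulrA; split=> //; apply: PM.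
have sPJ x : P x -> J x by move=> Px; exists x, 0; rewrite mul0r addr0.
have [y [b [/PE[e ->] E1]]] : J 1.
  case: (pselect (J 1)) => // nJ1; case: nPa.
  by apply: (maxP J idJ sPJ nJ1); exists 0, 1; rewrite mul1r add0r.
exists (b * \sum_(i < k) (pi * e) ^+ i), (e ^+ k).
have -> : a * (b * \sum_(i < k) (pi * e) ^+ i) =
    (1 - pi * e) * \sum_(i < k) (pi * e) ^+ i.
  by rewrite mulrA; congr (_ * _); rewrite {1}E1 addrAC subrr add0r mulrC.
by rewrite -exprMn -[RHS]opprB subrX1 -[RHS]mulNr opprB.
Qed.

Section FreeModule.
Variables (O : idomainType) (R : finComNzRingType) (red : {rmorphism O -> R}).
Variables (n k : nat) (pi : O).
Hypothesis pi_nz : pi != 0.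
Hypothesis k_gt0 : (0 < k)%N.
Hypothesis red_onto : forall r, exists a, red a = r.
Hypothesis red_ker : forall a, red a = 0 <-> pdvd pi k a.
Local Notation F := (freemod red n).

Lemma freemod_scaleE (a : O) (x : F) : a *: x = (red a *: (x : 'rV[R]_n) : F).
Proof. by []. Qed.

Lemma freemod_torsion (x : F) : pi ^+ k *: x = 0.
Proof.
rewrite freemod_scaleE (_ : red _ = 0) ?scale0r //.
by apply/red_ker; exists 1; rewrite mulr1.
Qed.

Lemma freemod_divisible : divisible pi k [set: F].
Proof.
move=> x _ px; have /choice[a aP] j : exists a, (x : 'rV[R]_n) 0 j = red (pi * a).
  have [a Ea] := red_onto ((x : 'rV[R]_n) 0 j).
  have /red_ker : red (pi ^+ k.-1 * a) = 0.
    have /rowP/(_ j) : pi ^+ k.-1 *: (x : F) = 0 :> 'rV[R]_n by [].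
    by rewrite !mxE rmorphM Ea.
  rewrite -{1}(prednK k_gt0) -addn1 => /(pdvd_mul pi_nz)[b Eb].
  by exists b; rewrite -Ea Eb.
exists (\row_j red (a j)); first by rewrite inE.
by apply/rowP=> j; rewrite !mxE aP rmorphM.
Qed.

(** Linearity over O and over R agree. *)
Lemma autF_linearP (g : {perm F}) :
  g \in autF red n <-> forall a (x y : F), g (a *: x + y) = a *: g x + g y.
Proof.
split=> [/autFP ling a x y | ling]; first exact: ling.
by apply/autFP=> r u v; have [a <-] := red_onto r; apply: ling.
Qed.

(** The submodule spanned by the m consecutive basis vectors from index s. *)
Definition std_free (s m : nat) : {set F} :=
  [set x : F | [forall j : 'I_n,
     ((s <= j < s + m)%N) || ((x : 'rV[R]_n) 0 j == 0)]].

Lemma std_free_typed s m : (s + m <= n)%N -> typed pi (std_free s m) (nseq m k).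
Proof.
move=> le_n; pose v (i : nat) : F := \row_(j < n) ((j : nat) == s + i)%N%:R.
have combE c (j : 'I_n) : (comb (size (nseq m k)) v c : 'rV[R]_n) 0 j =
    if (s <= j < s + m)%N then red (c (j - s)%N) else 0.
  have -> : (comb (size (nseq m k)) v c : 'rV[R]_n) =
      \sum_(i < m) red (c i) *: (v i : 'rV[R]_n) by rewrite /comb size_nseq.
  rewrite summxE; case: ifP => [/andP[le_s lt_s] | out].
    have ltm : (j - s < m)%N by rewrite ltn_subLR.
    rewrite (bigD1 (Ordinal ltm)) //= !mxE subnKC // eqxx mulr1.
    rewrite big1 ?addr0 // => i ne_i.
    rewrite !mxE; case: eqP => [Ej | _]; last by rewrite mulr0.
    by case/eqP: ne_i; apply: val_inj; rewrite /= Ej addKn.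
  rewrite big1 // => i _; rewrite !mxE.
  case: eqP => [Ej | _]; last by rewrite mulr0.
  by move: out; rewrite Ej leq_addr ltn_add2l ltn_ord.
exists v; split=> [x | c].
  rewrite inE; split=> [/forallP x0 | [c ->]]; last first.
    by apply/forallP=> j; rewrite combE; case: ifP => // _; rewrite eqxx orbT.
  have /choice[a aP] (i : nat) : exists a, forall j : 'I_n, (j : nat) = (s + i)%N ->
      (x : 'rV[R]_n) 0 j = red a.
    case lt_n: (s + i < n)%N; last first.
      by exists 0 => j Ej; rewrite -Ej ltn_ord in lt_n.
    have [a Ea] := red_onto ((x : 'rV[R]_n) 0 (Ordinal lt_n)).
    by exists a => j Ej; rewrite Ea; congr ((x : 'rV[R]_n) 0 _); apply: val_inj.
  exists a; apply/rowP=> j; rewrite combE; have := x0 j.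
  case: ifP => [/andP[le_s _] _ | _ /eqP //].
  by apply: aP; rewrite subnKC.
split=> [E i | H].
  rewrite size_nseq => ltm; rewrite nth_nseq ltm; apply/red_ker.
  have lt_n : (s + i < n)%N by apply: leq_trans le_n; rewrite ltn_add2l.
  have := combE c (Ordinal lt_n); rewrite E mxE /= leq_addr ltn_add2l ltm /=.
  by rewrite addKn.
apply/rowP=> j; rewrite combE mxE; case: ifP => // /andP[le_s lt_s].
have ltm : (j - s < m)%N by rewrite ltn_subLR.
by apply/red_ker; have := H (j - s)%N; rewrite size_nseq nth_nseq ltm; apply.
Qed.

Lemma std_free_disjoint m (x : F) :
  x \in std_free 0 m -> x \in std_free m m -> x = 0.
Proof.
rewrite !inE => /forallP x0 /forallP xm; apply/rowP=> j; rewrite [RHS]mxE.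
have := xm j; have := x0 j; rewrite leq0n add0n /=.
by case: ltnP => /= [_ _ /eqP | _ /eqP].
Qed.

End FreeModule.

Lemma submod_sum (O : idomainType) (F : finLmodType O) (w z : {set F}) :
  is_submod w -> is_submod z -> is_submod [set a + b | a in w, b in z].
Proof.
move=> sw sz; split=> [|r _ _ /imset2P[a b wa zb ->] /imset2P[a' b' wa' zb' ->]].
  by apply/imset2P; exists 0 0; rewrite ?sw.1 ?sz.1 ?addr0.
apply/imset2P; exists (r *: a + a') (r *: b + b'); rewrite ?sw.2 ?sz.2 //.
by rewrite scalerDr addrACA.
Qed.

(** * The decomposition of the space of functions *)

Section Main.
Variables (O : idomainType) (P : O -> Prop) (k n m : nat).
Variables (R : finComNzRingType) (red : {rmorphism O -> R}) (pi : O).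
Hypothesis pi_nz : pi != 0.
Hypothesis PE : forall x, P x <-> exists b, x = pi * b.
Hypothesis pi_nunit : ~ pdvd pi 1 1.
Hypothesis local_pi : forall a, (exists b, a = pi * b) \/
  exists b c, a * b = 1 - pi ^+ k * c.
Hypothesis residues : finite_quotient P.
Hypothesis k_gt0 : (0 < k)%N.
Hypothesis redP : is_quotient (ideal_exp P k) red.
Hypothesis le_2m_n : (2 * m <= n)%N.
Local Notation F := (freemod red n).
Local Notation G := (autF red n).
Local Notation act d g := (('P^*)%act d g).
Implicit Types (d w y z : {set F}) (la nu : seq nat).

Let red_onto r : exists a, red a = r. Proof. exact: redP.1. Qed.
Let red_ker a : red a = 0 <-> pdvd pi k a.
Proof. by rewrite redP.2; apply: ideal_expE. Qed.
Let piF (x : F) : pi ^+ k *: x = 0. Proof. exact: freemod_torsion. Qed.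
Let divF : divisible pi k [set: F]. Proof. exact: freemod_divisible. Qed.

Let phi := nseq m k.
Let X := submods red n P phi.
(* the submodules of F *)
Let S := [set d : {set F} | `[< is_submod d >]].

Let SP d : reflect (is_submod d) (d \in S).
Proof. by rewrite inE; apply: asboolP. Qed.

Let submods_type la d :
  d \in submods red n P la <-> submod_type P (fun x => x \in d) la.
Proof. by rewrite inE; split=> /asboolP. Qed.

Let submodsP la d : d \in submods red n P la <-> typed pi d la.
Proof.
exact: (iff_trans (submods_type la d) (submod_typeP _ _ PE)).
Qed.

Let autP (g : {perm F}) :
  g \in G <-> forall a (u v : F), g (a *: u + v) = a *: g u + g v.
Proof. exact: autF_linearP. Qed.

Let aut_lin_on (g : {perm F}) d : g \in G -> lin_on d g.
Proof. by move/autP=> ling a u v _ _; apply: ling. Qed.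

Lemma extend_to_aut d (f : F -> F) :
  is_submod d -> lin_on d f -> {in d &, injective f} ->
  exists2 g : {perm F}, g \in G & {in d, g =1 f}.
Proof.
move=> sd linf injf.
have [g gf ling] := extend_to_perm k_gt0 local_pi piF divF sd linf injf.
by exists g => //; apply/autP.
Qed.

Lemma act_imset d (g : {perm F}) (f : F -> F) : {in d, g =1 f} -> act d g = f @: d.
Proof. by move=> E; apply: eq_in_imset. Qed.

Lemma submods_orbit la w : w \in submods red n P la ->
  submods red n P la = orbit 'P^* G w.
Proof.
move=> tw; apply/setP=> d; apply/idP/orbitP=> [td | [g Gg <-]]; last first.
  by rewrite (acts_act (submods_acts red n P la)).
have tw' := (submodsP _ _).1 tw.
have [f [linf injf Ef]] := typed_iso tw' ((submodsP _ _).1 td).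
have [g Gg gf] := extend_to_aut (typed_submod tw') linf injf.
by exists g; rewrite // (act_imset gf).
Qed.

Lemma submodules_capI d d' : d \in S -> d' \in S -> d :&: d' \in S.
Proof. by move=> /SP sd /SP sd'; apply/SP/submodI. Qed.

Lemma submodules_act d g : d \in S -> g \in G -> act d g \in S.
Proof. by move=> /SP sd Gg; apply/SP/(submod_imset sd)/aut_lin_on. Qed.

Lemma free_submodules : X \subset S.
Proof. by apply/subsetP=> y /submodsP ty; apply/SP/(typed_submod ty). Qed.

Let residue_count : exists q (rep : 'I_q -> O),
  (forall x, exists i, pdvd pi 1 (x - rep i)) /\
  (forall i j, pdvd pi 1 (rep i - rep j) -> i = j).
Proof.
have [s sP] := residues; apply: (residues_exist (s := s)) => x.
by have [y sy Pxy] := sP x; exists y => //; apply/PE.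
Qed.

Lemma card_socle_X y y' : y \in X -> y' \in X -> #|socle pi y| = #|socle pi y'|.
Proof.
have [q [rep [onto inj]]] := residue_count.
have card z : z \in X -> #|socle pi z| = (q ^ m)%N.
  move=> /submodsP tz.
  have := card_deep_socle pi_nz pi_nunit onto inj 0 tz.
  rewrite count_nseq /= k_gt0 mul1n => <-; apply: eq_card => x; rewrite [RHS]inE.
  apply/idP/andP=> [sx | []//]; split=> //; apply/existsP; exists x.
  by move: sx; rewrite inE expr0 scale1r eqxx andbT => /andP[].
by move=> Xy Xy'; rewrite !card.
Qed.

Lemma card_submods la y y' :
  y \in submods red n P la -> y' \in submods red n P la -> #|y| = #|y'|.
Proof.
by move=> ty; rewrite (submods_orbit ty) => /orbitP[g _ <-]; rewrite card_setact.
Qed.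

Lemma aut_trans_above d y y' : d \in S -> y \in X -> y' \in X ->
  d \subset y -> d \subset y' -> exists2 g, g \in 'C_G(d | 'P) & act y g = y'.
Proof.
move=> /SP sd Xy Xy' dy dy'.
have [/submodsP ty /submodsP ty'] := (Xy, Xy').
have [sy sy'] := (typed_submod ty, typed_submod ty').
have [f [linf injf fd fy]] := iso_above k_gt0 local_pi piF sd sy sy'
  (free_divisible pi_nz k_gt0 ty') (card_socle_X Xy Xy') dy dy'.
have [g Gg gf] := extend_to_aut sy linf injf.
exists g.
  apply/setIP; split=> //; apply/astabP=> x dx.
  by rewrite /= apermE gf ?fd // (subsetP dy).
rewrite (act_imset gf); apply/eqP; rewrite eqEcard card_in_imset //.
rewrite (card_submods Xy Xy') leqnn andbT.
by apply/subsetP=> _ /imsetP[x yx ->]; apply: fy.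
Qed.

(** The identity of w and the restriction of g to z glue to an injective map on
    w + z, which extends to F. *)
Lemma glue_aut w z g : w \in S -> z \in S -> g \in 'C_G(w :&: z | 'P) ->
  w :&: act z g = w :&: z -> exists2 k, k \in 'C_G(w | 'P) & act z k = act z g.
Proof.
move=> /SP sw /SP sz /setIP[Gg /astabP fix_g] cap_g.
have gE x : x \in w :&: z -> g x = x by move=> wzx; apply: fix_g.
have lin_id : lin_on w id by [].
have ling : lin_on z g by apply: aut_lin_on.
have [|h [linh hw hz]] := glue_linear sw sz lin_id ling.
  by move=> x /gE.
have s_sum := submod_sum sw sz.
have hE a b : a \in w -> b \in z -> h (a + b) = a + g b.
  move=> wa zb; have Sa : a \in [set a + b | a in w, b in z].
    by apply/imset2P; exists a 0; rewrite ?sz.1 ?addr0.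
  have Sb : b \in [set a + b | a in w, b in z].
    by apply/imset2P; exists 0 b; rewrite ?sw.1 ?add0r.
  by rewrite (lin_onD s_sum linh) // hw // hz.
have injh : {in [set a + b | a in w, b in z] &, injective h}.
  apply: (lin_on_inj s_sum linh) => _ /imset2P[a b wa zb ->].
  rewrite hE // => /eqP; rewrite addr_eq0 => /eqP Ea.
  have wg : g b \in w by rewrite -[g b]opprK -Ea -scaleN1r submodZ.
  have wzg : g b \in w :&: z.
    rewrite -cap_g inE wg; apply/imsetP; exists b => //.
  by rewrite Ea (perm_inj (gE _ wzg)) addNr.
have [h' Gh hh] := extend_to_aut s_sum linh injh.
exists h'.
  apply/setIP; split=> //; apply/astabP=> x wx; rewrite /= apermE hh ?hw //.
  by apply/imset2P; exists x 0; rewrite ?sz.1 ?addr0.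
apply: eq_in_imset => x zx /=; rewrite !apermE hh ?hz //.
by apply/imset2P; exists 0 x; rewrite ?sw.1 ?add0r.
Qed.

Let y0 : {set F} := std_free red n 0 m.

Lemma std_free_X : y0 \in X.
Proof.
apply/submodsP/std_free_typed => //.
by apply: leq_trans le_2m_n; rewrite add0n mul2n -addnn leq_addr.
Qed.

Lemma std_free_above d :
  d \in S -> d \subset y0 -> exists2 y, y \in X & y0 :&: y = d.
Proof.
move=> /SP sd dy0; pose c : {set F} := std_free red n m m.
have tc : typed pi c (nseq m k).
  by apply: std_free_typed => //; rewrite addnn -mul2n.
have Xc : c \in X by apply/submodsP.
have sy0 := typed_submod ((submodsP _ _).1 std_free_X).
have [f [linf injf Ef]] := cap_above k_gt0 local_pi piF sd sy0 (typed_submod tc)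
  (free_divisible pi_nz k_gt0 tc) (card_socle_X std_free_X Xc) dy0
  (@std_free_disjoint _ _ red n m).
exists (f @: y0) => //; have [g Gg gf] := extend_to_aut sy0 linf injf.
by rewrite -(act_imset gf) (acts_act (submods_acts red n P phi)) // std_free_X.
Qed.

Lemma type_leP la nu w : w \in submods red n P nu ->
  type_le P la nu <-> exists2 d, d \in submods red n P la & d \subset w.
Proof.
move=> tw; have stw := (submods_type _ w).1 tw.
split=> [[i] | [d td dw]].
  have [d [f [g [td dw _]]]] := embedding_inside i stw.
  by exists d => //; apply/submods_type.
have std := (submods_type _ d).1 td.
have sd := typed_submod ((submodsP _ _).1 td).
have sw := typed_submod ((submodsP _ _).1 tw).
by have [i _] := inclusion_embedding sd sw std stw dw.
Qed.

(** The class of an embedding of la in nu is the orbit of the submodule of w that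
    realizes it. *)
Lemma emb_classes_orbits la nu x w :
  x \in submods red n P la -> w \in submods red n P nu ->
  emb_classes P la nu #|orbits_below G x w|.
Proof.
move=> tx tw; set H := 'C_G[w | 'P^*].
have stw := (submods_type _ w).1 tw.
have sw := typed_submod ((submodsP _ _).1 tw).
have Ex := submods_orbit tx.
have emb d : d \in submods red n P la -> d \subset w ->
  exists (i : embedding P la nu) (f : {linear emb_src i -> F})
         (g : {linear emb_tgt i -> F}), realizes f g d w.
  move=> td; have sd := typed_submod ((submodsP _ _).1 td).
  have std := (submods_type _ d).1 td.
  exact: inclusion_embedding.
have /choice[c cP] (s : 'I_#|orbits_below G x w|) : exists i : embedding P la nu,
    exists d (f : {linear emb_src i -> F}) (g : {linear emb_tgt i -> F}),
    [/\ d \subset w, orbit 'P^* H d = enum_val s & realizes f g d w].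
  have /imsetP[d] := enum_valP s; rewrite inE -Ex => /andP[td dw] Es.
  by have [i [f [g ?]]] := emb d td dw; exists i, d, f, g.
exists c; split=> [s t eq_st | i].
  have [d [f [g [dw Ed real_s]]]] := cP s.
  have [d' [f' [g' [dw' Ed' real_t]]]] := cP t.
  have [h [linh injh hw hd]] := lin_on_of_emb_equiv real_s real_t eq_st.
  have [a Ga ah] := extend_to_aut sw linh injh.
  apply: enum_val_inj; rewrite -Ed -Ed'; apply/orbit_eqP.
  rewrite -hd -(act_imset (g := a)); last first.
    by move=> z dz; rewrite ah // (subsetP dw).
  rewrite orbit_sym mem_orbit //; apply/setIP; split=> //; apply/astab1P.
  by rewrite (act_imset ah).
have [d [f [g [std dw real_i]]]] := embedding_inside i stw.
have td := (submods_type _ d).2 std.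
have od : orbit 'P^* H d \in orbits_below G x w.
  by apply: imset_f; rewrite inE -Ex td.
pose s := enum_rank_in od (orbit 'P^* H d).
have [d' [f' [g' [dw' Ed' real_s]]]] := cP s.
have : d \in orbit 'P^* H d' by rewrite Ed' enum_rankK_in // orbit_refl.
case/orbitP=> a /setIP[Ga /astab1P aw] ad.
exists s; apply: emb_equiv_of_perm real_s real_i _ ad aw; exact/autP.
Qed.

Let type_exists : exists tp : {set F} -> seq nat, forall d, d \in S ->
  is_partition (tp d) /\ d \in submods red n P (tp d).
Proof.
have /choice[tp tpP] d : exists la,
    d \in S -> is_partition la /\ d \in submods red n P la.
  case Sd: (d \in S); last by exists [::].
  have [la par td] := typed_exists local_pi piF (elimT (SP d) Sd).
  by exists la => _; split=> //; apply/submodsP.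
by exists tp.
Qed.

Lemma submods_uniq la nu d : is_partition la -> is_partition nu ->
  d \in submods red n P la -> d \in submods red n P nu -> la = nu.
Proof.
move=> pla pnu /submodsP tla /submodsP tnu.
have [q [rep [onto inj]]] := residue_count.
exact: (typed_uniq pi_nz pi_nunit onto inj pla pnu tla tnu).
Qed.

(** The decomposition, for a given uniformizer pi. *)
Theorem layers_decomposition :
  exists (Lambda : seq (seq nat))
         (U : seq nat -> representation rat (autF red n)),
  [/\ uniq Lambda /\
      (forall la, la \in Lambda <-> is_partition la /\ type_le P la phi),
      (forall la, la \in Lambda -> mx_irreducible (U la)) /\
      (forall la nu, la \in Lambda -> nu \in Lambda ->
         mx_rsim (U la) (U nu) -> la = nu),
      mx_rsim (funrep red n P phi)
        (\big[@dadd_grepr _ _ _/grepr0]_(la <- Lambda) U la),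
      (forall la nu, la \in Lambda -> nu \in Lambda ->
         exists2 N, emb_classes P la nu N &
                    multiplicity (U la) (funrep red n P nu) N) &
      (forall la, la \in Lambda ->
         multiplicity (U la) (funrep red n P la) 1) /\
      (forall la nu, la \in Lambda -> nu \in Lambda -> ~ type_le P la nu ->
         multiplicity (U la) (funrep red n P nu) 0)].
Proof.
have [tp tpP] := type_exists.
(* Lambda lists the types of the submodules of y0 *)
pose below := [set d in S | d \subset y0].
pose Lambda := undup [seq tp d | d <- enum below].
have uL : uniq Lambda by apply: undup_uniq.
have LP la : la \in Lambda -> exists d, [/\ d \in S, d \subset y0, tp d = la,
    is_partition la & d \in submods red n P la].
  rewrite mem_undup => /mapP[d]; rewrite mem_enum inE => /andP[Sd dy0] ->.
  by have [par td] := tpP d Sd; exists d.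
have LE la : la \in Lambda <-> is_partition la /\ type_le P la phi.
  split=> [/LP[d [Sd dy0 _ par td]] | [par /(type_leP _ std_free_X)[d td dy0]]].
    by split=> //; apply/(type_leP _ std_free_X); exists d.
  have Sd : d \in S by apply/SP; move/submodsP: td => /typed_submod.
  have [par' td'] := tpP d Sd; rewrite (submods_uniq par par' td td').
  by rewrite mem_undup map_f // mem_enum inE Sd.
pose I := 'I_(size Lambda).
have nthL (i : I) : nth [::] Lambda i \in Lambda by apply: mem_nth.
have /choice[x xP] (i : I) := LP _ (nthL i).
have x_S i : x i \in S by have [] := xP i.
have x_y0 i : x i \subset y0 by have [] := xP i.
have x_t i : x i \in submods red n P (nth [::] Lambda i) by have [] := xP i.
have orb (i : I) : submods red n P (nth [::] Lambda i) = orbit 'P^* G (x i).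
  exact: submods_orbit.
have x_inj i j : x i \in orbit 'P^* G (x j) -> i = j.
  rewrite -orb => xij; have [_ _ _ pari ti] := xP i; have [_ _ _ parj _] := xP j.
  have E := submods_uniq pari parj ti xij.
  apply: val_inj; apply/eqP.
  by rewrite -(nth_uniq [::] (ltn_ord i) (ltn_ord j) uL) E.
have x_cover d : d \in S -> d \subset y0 -> exists i, d \in orbit 'P^* G (x i).
  move=> Sd dy0; have [par td] := tpP d Sd.
  have Ld : tp d \in Lambda by rewrite mem_undup map_f // mem_enum inE Sd.
  have lt : (index (tp d) Lambda < size Lambda)%N by rewrite index_mem.
  by exists (Ordinal lt); rewrite -orb nth_index.
have [U [irrU homU rkU injU decU]] :=
  layers_exist (submods_acts red n P phi) submodules_capI submodules_act
    aut_trans_above glue_aut free_submodules (submods_orbit std_free_X)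
    std_free_above x_S x_y0 x_inj x_cover.
(* outside Lambda the value is irrelevant *)
pose V la := oapp U grepr0 (insub (index la Lambda) : option I).
have VE (i : I) : V (nth [::] Lambda i) = U i.
  by rewrite /V index_uniq // valK.
have LI la : la \in Lambda -> exists i : I, la = nth [::] Lambda i.
  move=> Lla; have lt : (index la Lambda < size Lambda)%N by rewrite index_mem.
  by exists (Ordinal lt); rewrite /= nth_index.
have mult (i j : I) : multiplicity (U i) (funrep red n P (nth [::] Lambda j))
                  #|orbits_below G (x i) (x j)|.
  apply: multiplicity_hom_dim => //; rewrite -rkU //.
  apply: permrep_hom_dim; exact: orb.
exists Lambda, V; split.
- by split.
- split=> [la /LI[i ->] | la nu /LI[i ->] /LI[j ->]]; first by rewrite VE.
  by rewrite !VE => /injU ->.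
- rewrite (big_nth [::]) big_mkord (eq_bigr U) // => i _; exact: VE.
- move=> la nu /LI[i ->] /LI[j ->]; rewrite VE.
  exists #|orbits_below G (x i) (x j)|; last exact: mult.
  exact: emb_classes_orbits.
split=> [la /LI[i ->] | la nu /LI[i ->] /LI[j ->] nle]; rewrite VE.
  by have := mult i i; rewrite orbits_below_self.
have := mult i j; rewrite (_ : #|_| = 0%N) //; apply/eqP; rewrite cards_eq0.
apply/negPn/negP=> /orbits_below_neq0[d]; rewrite -orb => td dx; apply: nle.
by apply/(type_leP _ (x_t j)); exists d.
Qed.

End Main.

Theorem theorem1 (O : idomainType) (P : O -> Prop) (k n m : nat)
    (R : finComNzRingType) (red : {rmorphism O -> R}) :
  is_dvr P -> finite_quotient P ->
  (1 <= k)%N ->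
  is_quotient (ideal_exp P k) red ->
  (2 * m <= n)%N ->
  let phi := nseq m k in
  exists (Lambda : seq (seq nat))
         (U : seq nat -> representation rat (autF red n)),
  [/\ uniq Lambda /\
      (forall la, la \in Lambda <-> is_partition la /\ type_le P la phi),
      (forall la, la \in Lambda -> mx_irreducible (U la)) /\
      (forall la nu, la \in Lambda -> nu \in Lambda ->
         mx_rsim (U la) (U nu) -> la = nu),
      mx_rsim (funrep red n P phi)
        (\big[@dadd_grepr _ _ _/grepr0]_(la <- Lambda) U la),
      (forall la nu, la \in Lambda -> nu \in Lambda ->
         exists2 N, emb_classes P la nu N &
                    multiplicity (U la) (funrep red n P nu) N) &
      (forall la, la \in Lambda ->
         multiplicity (U la) (funrep red n P la) 1) /\
      (forall la nu, la \in Lambda -> nu \in Lambda -> ~ type_le P la nu ->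
         multiplicity (U la) (funrep red n P nu) 0)].
Proof.
move=> dvrP finP k_gt0 redP le_2m_n phi.
have [pi [pi_nz PE pi_nunit local_pi]] := dvr_uniformizer dvrP.
exact: layers_decomposition pi_nz PE pi_nunit (local_pi k) finP k_gt0 redP le_2m_n.
Qed.
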